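(* Let $\mathcal{C}$ be a small right-Ore category that is factor-finite, let $\Delta\colon \mathrm{Ob}(\mathcal{C})\to\mathcal{C}$ be a right-Garside map, and let $*\in\mathrm{Ob}(\mathcal{C})$. Then there is a contractible simplicial complex $X$ on which the group $G=\pi_1(\mathcal{C},* )$ acts, such that: the space $X$ is covered by the $G$-translates of compact subcomplexes $K_x$, $x\in\mathrm{Ob}(\mathcal{C})$ (one for each object); and every simplex stabilizer of the action is isomorphic to a finite index subgroup of $\mathcal{C}^\times(x,x)$ for some $x\in\mathrm{Ob}(\mathcal{C})$.
   Context: Conventions: a category is identified with its set of morphisms $\mathcal{C}$; its set of objects is $\mathrm{Ob}(\mathcal{C})$. $\mathcal{C}(x,y)$ denotes the set of morphisms from $y$ to $x$ (source $y$, target $x$), so $f\in\mathcal{C}(x,y)$, $g\in\mathcal{C}(y,z)$ imply $fg\in\mathcal{C}(x,z)$. $\mathcal{C}(x,-)$ is the set of morphisms with target $x$. $\mathcal{C}^\times$ is the set of invertible morphisms, $\mathcal{C}^\times(x,y)=\mathcal{C}^\times\cap\mathcal{C}(x,y)$. If $fg=h$, then $f$ is a left-factor of $h$, $g$ is a right-factor of $h$, and $h$ is a right-multiple of $f$. If $efg=h$ then $f$ is a factor of $h$. $\mathcal{C}$ is factor-finite if every morphism of $\mathcal{C}$ has only finitely many factors up to pre- and post-composition by invertibles. $\mathcal{C}$ is right-Ore if it is cancellative (left and right) and any two morphisms with the same target have a common right-multiple. A greatest common left-factor of two morphisms is a common left-factor of which every common left-factor is a left-factor. A right-Garside map on a left-cancellative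 category $\mathcal{C}$ is a map $\Delta\colon\mathrm{Ob}(\mathcal{C})\to\mathcal{C}$ with $\Delta(x)\in\mathcal{C}(x,-)$ for all $x$ such that, with $\mathrm{Div}(\Delta)=\{g\in\mathcal{C}: g\in \mathcal{C}(x,-) \text{ and } gh=\Delta(x) \text{ for some object } x \text{ and some } h\in\mathcal{C}\}$ and $\widetilde{\mathrm{Div}}(\Delta)=\{h\in\mathcal{C}: gh=\Delta(x)\text{ for some object } x \text{ and some } g\in\mathcal{C}(x,-)\}$, one has: $\mathrm{Div}(\Delta)$ generates $\mathcal{C}$; $\widetilde{\mathrm{Div}}(\Delta)\subseteq\mathrm{Div}(\Delta)$; and for every object $x$ and every $g\in\mathcal{C}(x,-)$ the elements $g$ and $\Delta(x)$ admit a greatest common left-factor. $\pi_1(\mathcal{C},* )$ is the group of endomorphisms of $*$ in the enveloping groupoid of $\mathcal{C}$ (the groupoid with the universal property that every functor from $\mathcal{C}$ to a groupoid factors uniquely through it); for right-Ore $\mathcal{C}$ this groupoid is the Ore localization, in which $\mathcal{C}$ embeds and every element has the form $fg^{-1}$ with $f,g\in\mathcal{C}$.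
   Formalization: Factor-finite is taken with position: factorizations h = efg are counted up to (e,f,g) ~ (eu⁻¹, ufv, v⁻¹g). Counting factors f only up to f ~ ufv makes the claim false, e.g. for 2×2 nonsingular matrices over certain DVRs with infinite residue field. *)

(* Defs.v *)
From HB Require Import structures.
From mathcomp Require Import all_boot all_order all_algebra.
From mathcomp Require Import all_classical all_reals.
From mathcomp Require Import topology normedtype.

Set Implicit Arguments.
Unset Strict Implicit.
Unset Printing Implicit Defensive.

Import Order.TTheory GRing.Theory Num.Theory numFieldNormedType.Exports.

Local Open Scope classical_set_scope.

(* [mor x y] is the set C(x, y) of morphisms with target x and source y, so
   that [mcomp f g], written fg on paper, is defined for f in C(x, y) and
   g in C(y, z) and lies in C(x, z). *)
Record category := Category {
  ob :> Type;
  mor : ob -> ob -> Type;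
  idm : forall x, mor x x;
  mcomp : forall x y z, mor x y -> mor y z -> mor x z;
  mcomp1m : forall x y (f : mor x y), mcomp (idm x) f = f;
  mcompm1 : forall x y (f : mor x y), mcomp f (idm y) = f;
  mcompA : forall x y z t (f : mor x y) (g : mor y z) (h : mor z t),
    mcomp f (mcomp g h) = mcomp (mcomp f g) h }.

Arguments mor {c} _ _.
Arguments idm {c} x.
Arguments mcomp {c x y z} _ _.

Declare Scope cat_scope.
Delimit Scope cat_scope with cat.
Notation "f * g" := (mcomp f g) : cat_scope.
Local Open Scope cat_scope.

Definition inverse_of (C : category) (x y : C) (f : mor x y) (g : mor y x) :=
  f * g = idm x /\ g * f = idm y.

Definition invertible (C : category) (x y : C) (f : mor x y) :=
  exists g : mor y x, inverse_of f g.

Record groupoid := Groupoid {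
  gcat :> category;
  gcat_inv : forall (x y : gcat) (f : mor x y), invertible f }.

Record functor (C D : category) := Functor {
  fob :> C -> D;
  fhom : forall x y, mor x y -> mor (fob x) (fob y);
  fhom1 : forall x, fhom (idm x) = idm (fob x);
  fhomM : forall x y z (f : mor x y) (g : mor y z),
    fhom (f * g) = fhom f * fhom g }.

Section FunctorComp.
Variables (C D E : category) (F : functor C D) (G : functor D E).

Let h x y (f : mor x y) : mor (G (F x)) (G (F y)) := fhom G (fhom F f).

Let h1 x : h (idm x) = idm (G (F x)).
Proof. by rewrite /h !fhom1. Qed.

Let hM x y z (f : mor x y) (g : mor y z) : h (f * g) = h f * h g.
Proof. by rewrite /h !fhomM. Qed.

Definition functor_comp : functor C E :=
  @Functor C E (fun x => G (F x)) h h1 hM.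
End FunctorComp.

Definition enveloping_groupoid (C : category) (E : groupoid)
    (iota : functor C E) :=
  forall (D : groupoid) (F : functor C D),
    exists! F' : functor E D, functor_comp iota F' = F.

Section Core.
Variable C : category.

Definition iso (x y : C) := {f : mor x y | invertible f}.

Lemma iso_inj x y (u v : iso x y) : sval u = sval v -> u = v.
Proof.
case: u v => [f hf] [g hg] /= fg; subst g.
by congr exist; exact: Prop_irrelevance.
Qed.

Lemma invertible1 (x : C) : invertible (idm x).
Proof. by exists (idm x); split; rewrite mcomp1m. Qed.

Lemma invertibleM x y z (f : mor x y) (g : mor y z) :
  @invertible C _ _ f -> invertible g -> invertible (f * g).
Proof.
move=> [f' [ff' f'f]] [g' [gg' g'g]]; exists (g' * f'); split.
  by rewrite mcompA -(mcompA f) gg' mcompm1.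
by rewrite mcompA -(mcompA g') f'f mcompm1.
Qed.

Definition core_cat : category.
refine (@Category C iso (fun x => exist _ (idm x) (invertible1 x))
  (fun x y z u v =>
     exist _ (sval u * sval v) (invertibleM (svalP u) (svalP v))) _ _ _).
- by move=> x y u; apply: iso_inj; exact: mcomp1m.
- by move=> x y u; apply: iso_inj; exact: mcompm1.
- by move=> x y z t u v w; apply: iso_inj; exact: mcompA.
Defined.

Lemma core_cat_inv (x y : core_cat) (f : mor x y) : invertible f.
Proof.
case: f => f hf; have [g [fg gf]] := hf.
have hg : invertible g by exists f.
by exists (exist _ g hg); split; apply: iso_inj.
Qed.

(* The groupoid of invertible morphisms of C. *)
Definition core : groupoid := Groupoid core_cat_inv.
End Core.

(* The group of endomorphisms of x in E; pi_1(C, pt) when E is the enveloping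
   groupoid of C, and C^x(pt, pt) when E is the core of C. *)
Definition Loop (E : groupoid) (x : E) : Type := mor x x.

Section LoopGroup.
Variables (E : groupoid) (x : E).

HB.instance Definition _ := gen_eqMixin (Loop x).
HB.instance Definition _ := gen_choiceMixin (Loop x).

Let inv (f : Loop x) : Loop x := sval (cid (gcat_inv f)).

Let mulVf : left_inverse (idm x : Loop x) inv mcomp.
Proof. by move=> f; rewrite /inv; case: cid => g []. Qed.

Let mulfV : right_inverse (idm x : Loop x) inv mcomp.
Proof. by move=> f; rewrite /inv; case: cid => g []. Qed.

HB.instance Definition _ := @isGroup.Build (Loop x) (idm x) inv mcomp
  (@mcompA E x x x x) (@mcomp1m E x x) (@mcompm1 E x x) mulVf mulfV.
End LoopGroup.

Section Divisibility.
Variable C : category.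

Definition left_cancellative :=
  forall (x y z : C) (f : mor x y) (g h : mor y z), f * g = f * h -> g = h.

Definition right_cancellative :=
  forall (x y z : C) (f g : mor x y) (h : mor y z), f * h = g * h -> f = g.

Definition right_ore :=
  [/\ left_cancellative, right_cancellative &
      forall (x y z : C) (f : mor x y) (g : mor x z),
        exists t (f' : mor y t) (g' : mor z t), f * f' = g * g'].

Definition left_factor (x y z : C) (f : mor x y) (h : mor x z) :=
  exists g : mor y z, f * g = h.

Definition is_left_gcd (x y z w : C)
    (d : mor x w) (g : mor x y) (h : mor x z) :=
  [/\ left_factor d g, left_factor d h &
      forall v (c : mor x v),
        left_factor c g -> left_factor c h -> left_factor c d].

(* A factor f of h = efg, together with its position in h. *)
Record factor (x z : C) (h : mor x z) := Factor {
  ftgt : C;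
  fsrc : C;
  fpre : mor x ftgt;
  fmor : mor ftgt fsrc;
  fpost : mor fsrc z;
  factorE : fpre * fmor * fpost = h }.

(* Pre- and post-composition by invertibles: (e, f, g) is identified with
   (e u^-1, u f v, v^-1 g).  The rest of the factorization moves along with f,
   so that two left-factors of h are identified when they differ by an
   invertible on the right.  Identifying f with every u f v, regardless of
   position, would be too coarse: the nonsingular n x n matrices over a discrete
   valuation ring would then be factor-finite for every residue field, by the
   Smith normal form. *)
Definition factor_assoc (x z : C) (h : mor x z) (a b : factor h) :=
  exists (u : mor (ftgt b) (ftgt a)) (v : mor (fsrc a) (fsrc b)),
    [/\ invertible u, invertible v & [/\ fpre b * u = fpre a,
        fmor b = u * fmor a * v & v * fpost b = fpost a]].

Definition factor_finite :=
  forall (x z : C) (h : mor x z),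
    exists (n : nat) (r : 'I_n -> factor h),
      forall a : factor h, exists i, factor_assoc (r i) a.

Inductive cat_generated (S : forall x y : C, mor x y -> Prop) :
    forall x y : C, mor x y -> Prop :=
  | generated1 x : cat_generated S (idm x)
  | generated_in x y (f : mor x y) : S x y f -> cat_generated S f
  | generatedM x y z (f : mor x y) (g : mor y z) :
      cat_generated S f -> cat_generated S g -> cat_generated S (f * g).

Section Garside.
(* [delta x] is the source of the morphism [Delta x], whose target is x. *)
Variables (delta : C -> C) (Delta : forall x, mor x (delta x)).

Definition Div (x y : C) (g : mor x y) : Prop := left_factor g (Delta x).

Inductive coDiv : forall y z : C, mor y z -> Prop :=
  CoDiv x y (g : mor x y) (h : mor y (delta x)) : g * h = Delta x -> coDiv h.

Definition right_garside :=
  [/\ forall (x y : C) (g : mor x y), cat_generated Div g,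
      forall (x y : C) (h : mor x y), coDiv h -> Div h &
      forall (x y : C) (g : mor x y),
        exists w (d : mor x w), is_left_gcd d g (Delta x)].
End Garside.
End Divisibility.

Section Groups.
Local Open Scope group_scope.

Definition subgroup (G : groupType) (H : set G) :=
  [/\ H 1, forall g h, H g -> H h -> H (g * h) & forall g, H g -> H g^-1].

Definition finite_index (G : groupType) (H : set G) :=
  finite_set [set [set g * h | h in H] | g in [set: G]].

Definition isomorphic_subgroups (G G' : groupType) (H : set G) (H' : set G') :=
  exists phi : G -> G',
    set_bij H H' phi /\
    forall g h, H g -> H h -> phi (g * h) = phi g * phi h.
End Groups.

Record simplicial_complex := SimplicialComplex {
  vertex :> choiceType;
  simplex : set (set vertex);
  simplex_finite : forall s, simplex s -> finite_set s;
  simplex_nonempty : forall s, simplex s -> s !=set0;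
  simplex_vertex : forall v, simplex [set v];
  simplex_face : forall s t, simplex s -> t `<=` s -> t !=set0 -> simplex t }.

Definition subcomplex (X : simplicial_complex) (K : set (set X)) :=
  K `<=` @simplex X /\
  forall s t, K s -> t `<=` s -> t !=set0 -> K t.

Section Realization.
Local Open Scope ring_scope.
Variables (R : realType) (X : simplicial_complex).

Definition carrier (t : X -> R) : set X := [set v | t v != 0].

(* The points of |X|, given by their barycentric coordinates. *)
Record realization := Realization {
  coord :> X -> R;
  coord_ge0 : forall v, 0 <= coord v;
  coord_carrier : simplex (carrier coord);
  coord_sum : \sum_(v \in [set: X]) coord v = 1 }.

HB.instance Definition _ := gen_eqMixin realization.
HB.instance Definition _ := gen_choiceMixin realization.

Definition closed_simplex (s : set X) : set realization :=
  [set t | carrier t `<=` s].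

Definition space_of (K : set (set X)) : set realization :=
  [set t | K (carrier t)].

(* The weak (CW) topology: a set is open when its trace on every closed simplex
   is open for the Euclidean topology. *)
Definition weak_open (U : set realization) :=
  forall s : set X, simplex s ->
    exists W : set {ptws X -> R}, open W /\
      closed_simplex s `&` U = closed_simplex s `&` [set t | W (coord t)].

Let weak_openT : weak_open setT.
Proof. by move=> s _; exists setT; split; [exact: openT|]. Qed.

Let weak_openI : setI_closed weak_open.
Proof.
move=> U1 U2 oU1 oU2 s ss.
have [W1 [oW1 e1]] := oU1 s ss; have [W2 [oW2 e2]] := oU2 s ss.
exists (W1 `&` W2); split; first exact: openI.
by rewrite setIIr e1 e2 -setIIr.
Qed.

Let weak_open_bigU (I : Type) (f : I -> set realization) :
  (forall i, weak_open (f i)) -> weak_open (\bigcup_i f i).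
Proof.
move=> of_ s ss; have /choice[W hW] := fun i => of_ i s ss.
exists (\bigcup_i W i); split.
  by apply: bigcup_open => i _; case: (hW i).
rewrite setI_bigcupr (eq_bigcupr (fun i _ => (hW i).2)) -setI_bigcupr.
by [].
Qed.

HB.instance Definition _ := isOpenTopological.Build realization
  weak_openT weak_openI weak_open_bigU.
End Realization.

Arguments space_of R {X} K.

Section Contractible.
Local Open Scope ring_scope.

Definition contractible (R : realType) (T : topologicalType) :=
  exists (p : T) (H : T * R -> T),
    [/\ {within [set: T] `*` `[0, 1], continuous H},
        forall t, H (t, 0) = t & forall t, H (t, 1) = p].
End Contractible.

Section Actions.
Local Open Scope group_scope.
Variables (G : groupType) (X : simplicial_complex).

Record simplicial_action := SimplicialAction {
  act :> G -> X -> X;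
  act1 : forall v, act 1 v = v;
  actM : forall g h v, act (g * h) v = act g (act h v);
  act_simplex : forall g s, simplex s -> simplex (act g @` s) }.

Variable a : simplicial_action.

Definition translate (g : G) (K : set (set X)) : set (set X) :=
  [set a g @` s | s in K].

Definition stabilizer (s : set X) : set G := [set g | a g @` s = s].
End Actions.

(* Main.v *)
(* In the enveloping groupoid the cosets f C^x, with f in E(pt, -), form a poset
   under right-divisibility on which G acts, and f |-> f Delta induces a
   monotone map up.  X is the flag complex whose edges join x <= y when
   y <= up x.

   For x <= h the gcd of x^-1 h and Delta gives the largest element nudge h x of
   [x, h] below up x.  For an elementary chain x_0 < ... < x_k below h one has
   x_i <= ... <= x_k <= nudge h x_0 <= ... <= nudge h x_i <= up x_i, so moving
   mass from the bottom of the chain first is a homotopy inside X from the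
   identity to nudge h.  Iterating it contracts the part of X below h onto h.
   The elements B n = up^n b are cofinal, and a simplex with a vertex below B n
   lies below B n.+1; so the contraction onto B n.+1, slowed down by the mass
   below B n, extends to X.  Performing these for n = 0, 1, ... takes each point
   t, after a time depending continuously on t, to the trajectory of b, along
   which it then travels back to b.

   A chain with bottom [f], f in E(pt, x), lies in [[f], [f Delta]], which is
   finite by factor-finiteness; G acts simply transitively on E(pt, x), whence
   the K_x; and g |-> f^-1 g f embeds the stabilizer into C^x(x, x). *)
From HB Require Import structures.
Require Import Defs.
From mathcomp Require Import all_boot all_order all_algebra.
From mathcomp Require Import all_classical all_reals.
From mathcomp Require Import topology normedtype.
From mathcomp Require Import interval_inference finmap.

Set Implicit Arguments.
Unset Strict Implicit.
Unset Printing Implicit Defensive.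

Import Order.TTheory GRing.Theory Num.Theory numFieldNormedType.Exports.

Local Open Scope classical_set_scope.

(** * Topology of the realization *)

Section ContinuousOn.
Local Open Scope ring_scope.
Variable R : realType.

(* Continuity of f on A x R for the subspace topology; f may take junk values
   off A. *)
Definition continuous_on (T U : topologicalType) (A : set T) (f : T * R -> U) :=
  forall t r, A t ->
    f @ filter_prod (within A (nbhs t)) (nbhs r) --> f (t, r).

Lemma near_within_fst (T : topologicalType) (A : set T) (t : T) (r : R) :
  \forall z \near filter_prod (within A (nbhs t)) (nbhs r), A z.1.
Proof.
exists (A, setT) => /=; last by move=> z [].
by split; [exact: withinT|exact: filterT].
Qed.

Lemma continuous_on_comp (T U V : topologicalType) (A : set T) (B : set U)
    (f : U * R -> V) (g : T * R -> U) (c : T * R -> R) :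
  continuous_on B f -> continuous_on A g -> (forall t r, A t -> B (g (t, r))) ->
  continuous_on A c -> continuous_on A (fun z => f (g z, c z)).
Proof.
move=> cf cg AB cc t r At; have Bg := AB t r At.
have gB : g @ filter_prod (within A (nbhs t)) (nbhs r) -->
    within B (nbhs (g (t, r))).
  move=> P /= /(cg _ r At) /=; apply: filterS2 (near_within_fst A t r).
  by move=> -[t' r'] /= At'; apply; exact: AB.
exact: (cvg_comp _ _ (cvg_pair gB (cc t r At)) (cf _ (c (t, r)) Bg)).
Qed.

Lemma continuous_onT (T U : topologicalType) (f : T * R -> U) :
  continuous_on setT f <-> continuous f.
Proof.
rewrite /continuous_on; split=> [h [t r]|h t r _].
  by have := h t r I; rewrite withinET.
by rewrite withinET; exact: h.
Qed.

Lemma filter_prod_within (T : topologicalType) (A : set T) (t : T) (r : R) :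
  filter_prod (within A (nbhs t)) (nbhs r) --> (t, r).
Proof.
move=> P [[P1 P2] [/= h1 h2 h]]; exists (P1, P2) => //; split=> //=.
by rewrite /within/=; apply: filterS h1 => u P1u _.
Qed.

Lemma continuous_continuous_on (T U : topologicalType) (A : set T)
    (f : T * R -> U) :
  continuous f -> continuous_on A f.
Proof.
move=> cf t r At; apply: cvg_trans (cf (t, r)); apply: cvg_app.
exact: filter_prod_within.
Qed.

Lemma continuous_on_eq (T U : topologicalType) (A : set T) (f g : T * R -> U) :
  (forall t r, A t -> f (t, r) = g (t, r)) -> continuous_on A f ->
  continuous_on A g.
Proof.
move=> fg cf t r At; rewrite -fg// => P /(cf t r At) /=.
apply: filterS2 (near_within_fst A t r) => -[t' r'] /= At'.
by rewrite fg.
Qed.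

End ContinuousOn.

Section RealizationTopology.
Local Open Scope ring_scope.
Variables (R : realType) (X : simplicial_complex).
Local Notation RX := (realization R X).

Lemma realization_eq (t u : RX) : (forall v, t v = u v) -> t = u.
Proof.
case: t u => [t t0 tc t1] [u u0 uc u1] /= tu.
have {}tu : t = u by apply/funext.
by subst u; congr Realization; exact: Prop_irrelevance.
Qed.

Lemma realization_openE (U : set RX) : open U = weak_open U.
Proof. by []. Qed.

Lemma carrier_nonempty (t : RX) : carrier t !=set0.
Proof. exact: simplex_nonempty (coord_carrier t). Qed.

Lemma coord_continuous (v : X) : continuous (fun t : RX => t v).
Proof.
apply/continuousP => U oU; rewrite realization_openE => s ss.
exists [set f : {ptws X -> R} | U (f v)].
split=> //; apply: (open_comp (f := fun f : {ptws X -> R} => f v)) => // f _.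
exact: (proj_continuous (K := fun=> R)).
Qed.

Lemma coord_sumE (A : {fset X}) (t : RX) : carrier t `<=` [set` A] ->
  \sum_(v <- A) t v = 1.
Proof.
move=> tA; rewrite -(coord_sum t) (fsbigTE A)// => v vA.
by apply/eqP; apply: contraNT vA => /tA.
Qed.

Lemma cvg_ptws (I : choiceType) (F : set_system {ptws I -> R})
    (f : {ptws I -> R}) :
  Filter F ->
  (forall v, (fun g : {ptws I -> R} => g v) @ F --> f v) -> F --> f.
Proof.
move=> FF h; apply/cvg_sup => v B [C [[D oD <-] Cf CB]].
have : nbhs (f v) D.
  by apply: open_nbhs_nbhs; split.
by move=> /(h v) /=; apply: (@filterS _ F FF) => z Dz; exact: CB.
Qed.

(** The weak topology and the pointwise one agree on each closed simplex, and carriers inside the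
    finite set [V] leave only finitely many closed simplices to test. *)
Lemma cvg_realization (T : Type) (F : set_system T) (FF : Filter F)
    (g : T -> RX) (t : RX) (V : set X) :
  finite_set V -> (\forall z \near F, carrier (g z) `<=` V) ->
  (forall v, g z v @[z --> F] --> t v) -> g @ F --> t.
Proof.
move=> finV gV gt U; rewrite nbhsE => -[O [oO Ot] OU].
(* One possible carrier [A] at a time. A non-simplex never occurs as a carrier, and an [A] missing a
   vertex of [carrier t] ceases to occur, since that coordinate becomes nonzero near the limit. *)
suff key (A : {fset X}) :
    \forall z \near F, carrier (g z) = [set` A] -> O (g z).
  have := filter_bigI (D := fpowerset (fset_set V)) FF (fun A _ => key A).
  apply: filterS2 gV => z gzV /(_ (fset_set (carrier (g z)))) h; apply: OU.
  have fing : finite_set (carrier (g z)) by exact: sub_finite_set finV.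
  apply: h; last by rewrite fset_setK.
  rewrite /= fpowersetE; apply/fsubsetP => v.
  by rewrite !in_fset_set// => /set_mem /gzV /mem_set.
have [sA|nsA] := pselect (simplex [set` A]); last first.
  by apply: nearW => z gA; case: nsA; rewrite -gA; exact: coord_carrier.
have [tA|/existsNP[v /not_implyP[tv Av]]] := pselect (carrier t `<=` [set` A]).
  rewrite realization_openE in oO; have [W [oW OW]] := oO _ sA.
  have Wt : W (t : X -> R).
    by have : (closed_simplex [set` A] `&` O) t by []; rewrite OW => -[].
  have : (fun z => (g z : X -> R) : {ptws X -> R}) @ F -->
      ((t : X -> R) : {ptws X -> R}).
    exact: cvg_ptws.
  move=> /(_ W) /(_ (open_nbhs_nbhs (conj oW Wt))).
  apply: (@filterS _ F FF) => z Wz gA.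
  have : (closed_simplex [set` A] `&` [set t | W (t : X -> R)]) (g z).
    by split=> //=; rewrite /closed_simplex/= gA.
  by rewrite -OW => -[].
have : \forall z \near F, g z v != 0 by apply: cvgr_neq0 (gt v) tv.
apply: filterS => z gzv gA.
by case: Av; rewrite -gA.
Qed.

(** The weak topology is defined on the realization alone, so the factor [R] calls for a tube
    argument: around the given time there is a compact interval [J], and the points whose whole tube
    over [J] lands in [O] form an open set. *)
Lemma continuous_on_closed_simplex (U : topologicalType) (A : set X)
    (f : RX * R -> U) :
  (forall s, simplex s -> s `<=` A -> continuous_on (closed_simplex s) f) ->
  continuous_on (closed_simplex A) f.
Proof.
move=> cf t0 r0 At0 V; rewrite nbhsE => -[O [oO Of] OV].
have /(cf _ (coord_carrier t0) At0 t0 r0) : nbhs (f (t0, r0)) O.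
  exact: open_nbhs_nbhs.
move/(_ (@subset_refl _ _)) => -[[P1 P2] [/= hP1 hP2] hP].
have {}hP1 : P1 t0.
  by apply: (nbhs_singleton hP1) => //.
have [e eP2] : exists e : {posnum R}, `[r0 - e%:num, r0 + e%:num] `<=` P2.
  by have /nbhs_closedballP[e] := hP2; rewrite closed_ball_itv//; exists e.
pose J := [set` `[r0 - e%:num, r0 + e%:num]%R] : set R.
(* Points off [closed_simplex A] lie in [N] vacuously, so that openness of [N] can be tested on
   every simplex. *)
pose N := [set t : RX | closed_simplex A t -> J `<=` [set r | O (f (t, r))]].
have oN : open N.
  rewrite realization_openE => s ss.
  have loc t : closed_simplex s t -> N t -> exists W : set {ptws X -> R},
     [/\ open W, W (t : X -> R) &
      closed_simplex s `&` [set t | W (t : X -> R)] `<=` N].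
    move=> st Nt.
    (* A vertex of [carrier t] outside [A] keeps a nonzero coordinate nearby, where membership in
       [N] is vacuous. *)
    have [tA|/existsNP[v /not_implyP[tv Av]]] :=
        pselect (carrier t `<=` A); last first.
      exists [set g | g v != 0]; split=> //.
      - apply: (@open_comp _ _ (fun g : {ptws X -> R} => g v) [set x | x != 0]).
          by move=> g _; exact: (proj_continuous (K := fun=> R)).
        exact: open_neq.
      - by move=> u [_ /= uv] /(_ _ uv).
    have sA : simplex (s `&` A).
      apply: (simplex_face ss) => //.
      have [v tv] := carrier_nonempty t; exists v.
      by split; [exact: st|exact: tA].
    have sAt : closed_simplex (s `&` A) t.
      by move=> v tv; split; [exact: st|exact: tA].
    (* Compactness of [J] yields one neighbourhood of [t] that serves all times in [J]. *)
    have /compact_near_coveringP := @segment_compact R (r0 - e%:num) (r0 + e%:num).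
    move=> /(_ _ (within (closed_simplex (s `&` A)) (nbhs t))).
    move=> /(_ (fun u r => O (f (u, r))) _) [].
      move=> r rJ.
      have /(cf _ sA (@subIsetr _ _ _) t r sAt) : nbhs (f (t, r)) O.
        by apply: open_nbhs_nbhs; split=> //; exact: Nt.
      move=> [[Q1 Q2] [/= hQ1 hQ2] hQ]; exists (Q2, Q1) => //= -[r' u] [/= ? ?].
      exact: (hQ (u, r')).
    move=> M [oM Mt MO]; have [W [oW MW]] := oM _ ss.
    have sMW u : closed_simplex s u -> M u <-> W (u : X -> R).
      by move=> su; have /seteqP[h1 h2] := MW; split=> h;
        [case: (h1 u)|case: (h2 u)].
    exists W; split=> //; first exact/sMW.
    move=> u [su /(sMW _ su) Mu] Au r rJ; apply: MO => //.
    by move=> v uv; split; [exact: su|exact: Au].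
  pose I := {t | closed_simplex s t /\ N t}.
  have /choice[W hW] : forall i : I, exists W : set {ptws X -> R},
     [/\ open W, W (sval i : X -> R) &
      closed_simplex s `&` [set t | W (t : X -> R)] `<=` N].
    by move=> [t [st Nt]]; exact: loc.
  exists (\bigcup_i W i); split.
    by apply: bigcup_open => i _; case: (hW i).
  apply/seteqP; split=> t [st]; last first.
    by move=> [i _ Wt]; split=> //; have [_ _] := hW i; exact.
  move=> Nt; split=> //; exists (exist _ t (conj st Nt)) => //.
  by case: (hW (exist _ t (conj st Nt))).
exists ([set t | J `<=` [set r | O (f (t, r))]], J) => /=; last first.
  by move=> [t r] [/= Nt rJ]; apply: OV; exact: Nt.
split.
  rewrite /within /=; apply: open_nbhs_nbhs; split=> // _ r Jr.
  apply: (hP (t0, r)); split => //=; exact: eP2.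
by apply/nbhs_closedballP; exists e; rewrite closed_ball_itv.
Qed.
End RealizationTopology.

(** * Running countably many homotopies one after another *)

Section Concatenation.
Local Open Scope ring_scope.
Variables (R : realType) (T : topologicalType) (A : set T).
Variable f : nat -> T * R -> T.

(** Stage [m] starts at time [m], being the identity before by [f_le0], and is never switched
    off. *)
Fixpoint stages n (z : T * R) : T :=
  if n is m.+1 then f m (stages m z, z.2 - m%:R) else z.1.

Definition concat (z : T * R) : T := stages (Num.trunc z.2).+1 z.

Hypothesis f_le0 : forall n t r, A t -> r <= 0 -> f n (t, r) = t.
Hypothesis f_stable : forall n t r, A t -> A (f n (t, r)).
Hypothesis f_continuous : forall n, continuous_on A (f n).

Lemma stages_stable n t r : A t -> A (stages n (t, r)).
Proof. by move=> At; elim: n => [|n IH] //=; exact: f_stable. Qed.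

Lemma stages_stationary n m t r : A t -> r <= n%:R -> (n <= m)%N ->
  stages m (t, r) = stages n (t, r).
Proof.
move=> At rn; elim: m => [|m IH]; first by rewrite leqn0 => /eqP ->.
rewrite leq_eqVlt => /orP[/eqP <-//|nm] /=; rewrite f_le0//.
- exact: IH.
- exact: stages_stable.
- by rewrite subr_le0 (le_trans rn)// ler_nat.
Qed.

(** Stages that have not begun are the identity, so every sufficiently large number of stages gives
    the same value. *)
Lemma concatE n t r : A t -> r <= n%:R -> concat (t, r) = stages n (t, r).
Proof.
move=> At rn.
rewrite (_ : concat _ = stages (Num.trunc r).+1 (t, r))//.
have [le|/ltnW le] := leqP (Num.trunc r).+1 n.
  by symmetry; apply: stages_stationary; rewrite ?ltW ?truncnS_gt.
exact: stages_stationary.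
Qed.

Lemma concat_stable t r : A t -> A (concat (t, r)).
Proof. exact: stages_stable. Qed.

Lemma concat_le0 t r : A t -> r <= 0 -> concat (t, r) = t.
Proof. by move=> At r0; rewrite (@concatE 0). Qed.

Lemma stages_continuous n : continuous_on A (stages n).
Proof.
elim: n => [|n IH].
  by apply: continuous_continuous_on => z; exact: cvg_fst.
apply: (continuous_on_comp (B := A)) => //.
- by move=> t r; exact: stages_stable.
- apply: continuous_continuous_on => z; apply: cvgB; last exact: cvg_cst.
  exact: cvg_snd.
Qed.

(** [Num.trunc] jumps at integers, but near a given time the number of stages can be frozen at one
    common bound. *)
Lemma concat_continuous : continuous_on A concat.
Proof.
move=> t r At; set n := (Num.trunc r).+1.
rewrite (concatE (n := n) At) ?ltW ?truncnS_gt// => P.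
move=> /(@stages_continuous n t r At) /=.
have : \forall z \near filter_prod (within A (nbhs t)) (nbhs r),
    A z.1 /\ z.2 < n%:R.
  exists (A, [set r | r < n%:R]) => //=; split; first exact: withinT.
  apply: open_nbhs_nbhs; split; last exact: truncnS_gt.
  exact: open_lt.
by apply: filterS2 => -[u s] /= [Au sn]; rewrite (concatE (n := n) Au) ?ltW.
Qed.

End Concatenation.

(** * The poset of a Garside map and its flag complex *)

Section FlagComplex.
Variables (V : choiceType) (adj : V -> V -> Prop).

Definition clique (s : set V) :=
  [/\ finite_set s, s !=set0 & forall v w, s v -> s w -> adj v w].

Hypothesis adj_refl : forall v, adj v v.

Definition flag_complex : simplicial_complex.
refine (@SimplicialComplex V clique _ _ _ _).
- by move=> s [].
- by move=> s [].
- by move=> v; split; [exact: finite_set1|exists v|move=> x y /= -> ->].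
- move=> s t [fs _ sadj] ts t0; split=> //; first exact: sub_finite_set fs.
  by move=> v w /ts sv /ts sw; exact: sadj.
Defined.

End FlagComplex.

(* The order is given by right-divisibility and up is right multiplication by
   Delta. *)
Record garside_poset := GarsidePoset {
  gvertex :> choiceType;
  gle : gvertex -> gvertex -> Prop;
  up : gvertex -> gvertex;
  gle_refl : forall x, gle x x;
  gle_trans : forall x y z, gle x y -> gle y z -> gle x z;
  gle_anti : forall x y, gle x y -> gle y x -> x = y;
  gle_up : forall x, gle x (up x);
  up_mono : forall x y, gle x y -> gle (up x) (up y);
  gle_meet : forall x h, gle x h -> exists c,
    [/\ gle x c, gle c h, gle c (up x) &
        forall y, gle x y -> gle y h -> gle y (up x) -> gle y c];
  gle_ind : forall Q : gvertex -> gvertex -> Prop, (forall x, Q x x) ->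
    (forall x y z, gle x y -> gle y (up x) -> Q y z -> Q x z) ->
    forall x y, gle x y -> Q x y;
  gle_directed : forall x y, exists z, gle x z /\ gle y z }.

Arguments gle {g} _ _.
Arguments up {g} _.

Section GarsidePoset.
Variable P : garside_poset.
Implicit Types x y z h v w : P.

Definition gadj v w := gle v w /\ gle w (up v) \/ gle w v /\ gle v (up w).

Lemma gadj_refl v : gadj v v.
Proof. by left; split; [exact: gle_refl|exact: gle_up]. Qed.

Definition gcomplex := flag_complex gadj_refl.

Lemma gle_total (s : set P) v w : @simplex gcomplex s -> s v -> s w ->
  gle v w \/ gle w v.
Proof. by move=> [_ _ sadj] sv sw; case: (sadj _ _ sv sw) => -[]; tauto. Qed.

Lemma gle_up_simplex (s : set P) v w : @simplex gcomplex s -> s v -> s w ->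
  gle v (up w).
Proof.
move=> [_ _ sadj] sv sw; case: (sadj _ _ sv sw) => -[h1 h2]; last by [].
exact: gle_trans h1 (gle_up w).
Qed.

(** Where [x] is not below [h], the value [x] is a default. *)
Definition nudge h x : P :=
  if pselect (gle x h) is left xh then sval (cid (gle_meet xh)) else x.

Lemma nudgeP h x : gle x h ->
  [/\ gle x (nudge h x), gle (nudge h x) h, gle (nudge h x) (up x) &
    forall y, gle x y -> gle y h -> gle y (up x) -> gle y (nudge h x)].
Proof.
by move=> xh; rewrite /nudge; case: pselect => // xh'; case: cid.
Qed.

(** Maximality of [nudge h y] applies to [nudge h x] only if [y] lies below it, which holds when [y]
    is below [up x]. Hence the induction along elementary steps. *)
Lemma nudge_mono h x y : gle x y -> gle y h -> gle (nudge h x) (nudge h y).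
Proof.
pose Q x y := gle y h -> gle (nudge h x) (nudge h y) /\ gle x h.
suff [Qxx Qstep] : (forall x, Q x x) /\
    (forall x y z, gle x y -> gle y (up x) -> Q y z -> Q x z).
  by move=> xy yh; have [] := gle_ind Qxx Qstep xy yh.
split=> {x y} [x xh|x y z xy yx Qyz zh].
  by split => //; exact: gle_refl.
have [yz yh] := Qyz zh; have xh := gle_trans xy yh.
split=> //; apply: gle_trans yz.
have [_ ch cx _] := nudgeP xh; have [_ _ _] := nudgeP yh; apply=> //.
  by have [_ _ _] := nudgeP xh; exact.
exact: gle_trans cx (up_mono xy).
Qed.

Lemma iter_nudge_le h x n : gle x h -> gle (iter n (nudge h) x) h.
Proof. by move=> xh; elim: n => //= n /nudgeP[]. Qed.

Lemma nudge_top h : nudge h h = h.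
Proof.
have [hc ch _ _] := nudgeP (gle_refl h); exact: gle_anti.
Qed.

Lemma iter_nudge_top h n : iter n (nudge h) h = h.
Proof. by elim: n => //= n ->; exact: nudge_top. Qed.

Lemma iter_nudge_mono h n x y : gle x y -> gle y h ->
  gle (iter n (nudge h) x) (iter n (nudge h) y).
Proof.
move=> xy yh; elim: n => //= n IH; apply: nudge_mono => //.
exact: iter_nudge_le.
Qed.

(** For an elementary step from [x] to [y] one nudge of [x] already passes [y], so [n.+1] nudges of
    [x] dominate [n] nudges of [y]. *)
Lemma nudge_reaches_top h x : gle x h -> exists n, iter n (nudge h) x = h.
Proof.
pose Q x y := y = h -> gle x h /\ exists n, iter n (nudge h) x = h.
suff [Qxx Qstep] : (forall x, Q x x) /\
    (forall x y z, gle x y -> gle y (up x) -> Q y z -> Q x z).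
  by move=> xh; have [] := gle_ind Qxx Qstep xh erefl.
split=> {x} [x ->|x y z xy yx Qyz zh].
  by split; [exact: gle_refl|exists 0%N].
have [yh [n nh]] := Qyz zh; have xh := gle_trans xy yh.
split=> //; exists n.+1; apply: gle_anti; first exact: iter_nudge_le.
rewrite -[X in gle X]nh iterSr; apply: iter_nudge_mono.
  by have [_ _ _] := nudgeP xh; exact.
by have [] := nudgeP xh.
Qed.

Definition height h x : nat :=
  if pselect (exists n, iter n (nudge h) x == h) is left e then ex_minn e else 0.

Lemma heightP h x n : gle x h -> (height h x <= n)%N -> iter n (nudge h) x = h.
Proof.
move=> xh; rewrite /height; case: pselect => [e|]; last first.
  by case; have [m mh] := nudge_reaches_top xh; exists m; exact/eqP.
case: ex_minnP => m /eqP mh _ mn.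
by rewrite -(subnK mn) iterD mh iter_nudge_top.
Qed.

Lemma height_le h x n : iter n (nudge h) x = h -> (height h x <= n)%N.
Proof.
move=> nh; rewrite /height; case: pselect => // e.
by case: ex_minnP => m _; apply; rewrite nh.
Qed.

Lemma height_adj h x y : gle x y -> gle y (up x) -> gle y h ->
  (height h x <= (height h y).+1)%N.
Proof.
move=> xy yx yh; have xh := gle_trans xy yh; apply: height_le.
apply: gle_anti; first exact: iter_nudge_le.
rewrite -[X in gle X](heightP yh (leqnn _)) iterSr; apply: iter_nudge_mono.
  by have [_ _ _] := nudgeP xh; exact.
by have [] := nudgeP xh.
Qed.

(** The lower of two vertices is at most one nudge behind, and the higher one is never behind by
    monotonicity. The weights in [cutoff] rest on this bound. *)
Lemma height_simplex h (s : set P) x y : @simplex gcomplex s -> s x -> s y ->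
  gle x h -> gle y h -> (height h x <= (height h y).+1)%N.
Proof.
move=> ss sx sy xh yh; have [xy|yx] := gle_total ss sx sy.
  by apply: height_adj => //; exact: gle_up_simplex ss sy sx.
apply: height_le; apply: gle_anti; first exact: iter_nudge_le.
rewrite -[X in gle X](heightP yh (leqnSn _)); exact: iter_nudge_mono.
Qed.

Lemma le_iter_up x y : gle x y -> exists n, gle y (iter n up x).
Proof.
move: x y; apply: gle_ind => [x|x y z xy yx [n zn]].
  by exists 0%N; exact: gle_refl.
exists n.+1; apply: gle_trans zn _; rewrite iterSr.
by elim: n => //= n; exact: up_mono.
Qed.

Lemma le_iter_upS n x : gle (iter n up x) (iter n.+1 up x).
Proof. exact: gle_up. Qed.

Lemma le_iter_upW m n x : (m <= n)%N -> gle (iter m up x) (iter n up x).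
Proof.
move=> /subnK <-; elim: (n - m)%N => [|k IH]; first exact: gle_refl.
exact: gle_trans IH (le_iter_upS _ _).
Qed.

Lemma cofinal_iter_up b x : exists n, gle x (iter n up b).
Proof.
have [z [xz bz]] := gle_directed x b; have [n zn] := le_iter_up bz.
by exists n; exact: gle_trans zn.
Qed.

End GarsidePoset.

(** * Contracting the complex *)

Section Push.
Local Open Scope ring_scope.
Variables (R : realType) (P : garside_poset).
Local Notation X := (gcomplex P).
Local Notation RX := (realization R X).
Implicit Types (t : RX) (x y h v w : X) (r : R).

Definition below h : set X := [set x | gle x h].

Definition glt y x := gle y x /\ y <> x.

(** The carrier of [t] is a chain, so the intervals from [mass_below t x] to [mass_below t x + t x]
    tile [0, 1] from the lowest vertex upwards; each is the time during which [x] is emptied. *)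
Definition mass_below t x : R :=
  \sum_(y \in [set: X]) if `[< glt y x >] then t y else 0.

(* As r grows from 0 to 1, the mass of t is moved away starting with the lowest
   vertex of the carrier; shifted t x r is the mass that has left x. *)
Definition shifted t x r : R :=
  Num.min r (mass_below t x + t x) - Num.min r (mass_below t x).

Definition push_coord h t r v : R :=
  t v - shifted t v r +
  \sum_(x \in [set: X]) if nudge h x == v then shifted t x r else 0.

Lemma notin_carrier (A : {fset X}) t v :
  carrier t `<=` [set` A] -> v \notin A -> t v = 0.
Proof. by move=> tA vA; apply/eqP; apply: contraNT vA => /tA. Qed.

Lemma mass_belowE (A : {fset X}) t x : carrier t `<=` [set` A] ->
  mass_below t x = \sum_(y <- A) if `[< glt y x >] then t y else 0.
Proof.
by move=> tA; apply: fsbigTE => y yA; rewrite (notin_carrier tA yA) if_same.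
Qed.

Lemma carrier_fset t x y :
  exists A : {fset X}, [/\ carrier t `<=` [set` A], x \in A & y \in A].
Proof.
have ft := simplex_finite (coord_carrier t).
exists (x |` (y |` fset_set (carrier t)))%fset.
split; [|by rewrite !inE eqxx|by rewrite !inE eqxx orbT].
by move=> v tv; rewrite /= !inE in_fset_set// mem_set ?orbT.
Qed.

Lemma mass_below_ge0 t x : 0 <= mass_below t x.
Proof.
have [A [tA _ _]] := carrier_fset t x x; rewrite (mass_belowE _ tA).
by apply: sumr_ge0 => y _; case: ifP => // _; exact: coord_ge0.
Qed.

Lemma mass_below_le1 t x : mass_below t x + t x <= 1.
Proof.
have [A [tA xA _]] := carrier_fset t x x.
rewrite -(coord_sumE tA) (mass_belowE _ tA).
rewrite [X in X + _ <= _](big_fsetD1 x)//= [leRHS](big_fsetD1 x)//=.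
rewrite asboolF; last by case.
rewrite /= add0r addrC lerD2r; apply: ler_sum => y _.
by case: ifP => // _; exact: coord_ge0.
Qed.

Lemma mass_below_lt t x y : glt y x -> mass_below t y + t y <= mass_below t x.
Proof.
move=> yx; have [A [tA xA yA]] := carrier_fset t x y.
rewrite !(mass_belowE _ tA) [X in X + _ <= _](big_fsetD1 y)//=.
rewrite [leRHS](big_fsetD1 y)//= asboolF; last by case.
rewrite asboolT//= add0r addrC lerD2r; apply: ler_sum => z _.
case: ifPn => [/asboolP zy|_]; last by case: ifP => // _; exact: coord_ge0.
rewrite asboolT//; split; first exact: gle_trans zy.1 yx.1.
move=> zx; case: yx.2; apply: gle_anti => //; first exact: yx.1.
by rewrite -zx; exact: zy.1.
Qed.

Lemma shifted_ge0 t x r : 0 <= shifted t x r.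
Proof.
rewrite subr_ge0 le_min ge_min lexx/= ge_min.
by rewrite lerDl coord_ge0 orbT.
Qed.

Lemma shifted_le t x r : shifted t x r <= t x.
Proof.
rewrite /shifted lerBlDr; have := coord_ge0 t x.
set a := mass_below t x; move=> t0; rewrite addr_minr le_min; apply/andP; split.
  by rewrite ge_min lerDr t0.
by rewrite ge_min addrC lexx orbT.
Qed.

Lemma shifted_out t x r : t x = 0 -> shifted t x r = 0.
Proof. by move=> tx; rewrite /shifted tx addr0 subrr. Qed.

Lemma shifted_le0 t x r : r <= 0 -> shifted t x r = 0.
Proof.
move=> r0; have b0 := mass_below_ge0 t x; have t0 := coord_ge0 t x.
by rewrite /shifted !min_l ?subrr// (le_trans r0)// addr_ge0.
Qed.

Lemma shifted_lt t x r : shifted t x r != 0 -> t x != 0 /\ mass_below t x < r.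
Proof.
move=> n0; split; first by apply: contra_neq n0; exact: shifted_out.
rewrite ltNge; apply: contra_neqN n0 => rb; rewrite /shifted !min_l ?subrr//.
by rewrite (le_trans rb)// lerDl coord_ge0.
Qed.

Lemma shifted_gt t x r : t x - shifted t x r != 0 ->
  t x != 0 /\ r < mass_below t x + t x.
Proof.
move=> n0; split.
  by apply: contra_neq n0 => tx; rewrite (shifted_out _ tx) tx subrr.
rewrite ltNge; apply: contra_neqN n0 => rb; rewrite /shifted !min_r//.
- by rewrite [mass_below _ _ + _]addrC addrK subrr.
- by rewrite (le_trans _ rb)// lerDl coord_ge0.
Qed.

Lemma fsum_shiftedE (A : {fset X}) h t r v : carrier t `<=` [set` A] ->
  \sum_(x \in [set: X]) (if nudge h x == v then shifted t x r else 0) =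
  \sum_(x <- A) if nudge h x == v then shifted t x r else 0.
Proof.
move=> tA; apply: fsbigTE => x xA.
by rewrite shifted_out ?if_same// (notin_carrier tA xA).
Qed.

Lemma push_coord_ge0 h t r v : 0 <= push_coord h t r v.
Proof.
have [A [tA _ _]] := carrier_fset t v v.
rewrite /push_coord (fsum_shiftedE _ _ _ tA) addr_ge0 ?subr_ge0 ?shifted_le//.
by apply: sumr_ge0 => x _; case: ifP => // _; exact: shifted_ge0.
Qed.

Lemma carrier_push h t r v : push_coord h t r v != 0 ->
  (t v != 0 /\ r < mass_below t v + t v) \/
  exists x, [/\ v = nudge h x, t x != 0 & mass_below t x < r].
Proof.
rewrite /push_coord; have [->|/shifted_gt] :=
  eqVneq (t v - shifted t v r) 0; last by left.
have [A [tA _ _]] := carrier_fset t v v.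
rewrite add0r (fsum_shiftedE _ _ _ tA) => n0; right; apply: contrapT => nx.
move/eqP: n0; apply; apply: big1 => x _; case: eqP => // hx.
apply/eqP; apply: contra_notT nx => /shifted_lt [tx xr].
by exists x.
Qed.

Lemma push_coord_sum h t r : \sum_(v \in [set: X]) push_coord h t r v = 1.
Proof.
have ft := simplex_finite (coord_carrier t).
pose A := fset_set (carrier t); have tA : carrier t `<=` [set` A].
  by rewrite fset_setK.
pose B := (A `|` [fset nudge h x | x in A])%fset.
have tB : carrier t `<=` [set` B] by move=> v /tA /= vA; rewrite /= inE vA.
have BA x : x \in A -> nudge h x \in B.
  by move=> xA; rewrite inE in_imfset// orbT.
rewrite (fsbigTE B); last first.
  move=> v vB; rewrite /push_coord (fsum_shiftedE _ _ _ tA).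
  have tv := notin_carrier tB vB; rewrite shifted_out// tv subrr add0r.
  rewrite big_seq big1// => x xA; case: eqP => // hx.
  by move: vB; rewrite -hx BA.
rewrite big_split sumrB /= (coord_sumE tB).
rewrite -[X in 1 - X](fsbigTE B); last first.
  by move=> v vB; rewrite shifted_out// (notin_carrier tB vB).
under [X in _ + X]eq_bigr do rewrite (fsum_shiftedE _ _ _ tA).
(* Sorted by origin, the mass leaving [x] is counted once, at [nudge h x]. *)
rewrite exchange_big/= (fsbigTE A); last first.
  by move=> v vA; rewrite shifted_out// (notin_carrier tA vA).
rewrite [X in _ + X](_ : _ = \sum_(i <- A) shifted t i r) ?subrK//.
rewrite !big_seq; apply: eq_bigr => x xA.
rewrite (big_fsetD1 (nudge h x)) ?BA//= eqxx big_seq big1 ?addr0// => v.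
by rewrite !inE => /andP[/negPf vx _]; rewrite eq_sym vx.
Qed.

Lemma push_simplex h t r : carrier t `<=` below h ->
  @simplex X [set v | push_coord h t r v != 0].
Proof.
move=> th; have ts := coord_carrier t; have ft := simplex_finite ts.
(* If [x] has begun to move and [y] is not yet emptied, then [x] is below [y]: otherwise the
   interval of [y] would end before that of [x] begins. *)
have sep x y : t x != 0 -> t y != 0 -> mass_below t x < r ->
    r < mass_below t y + t y -> gle x y.
  move=> tx ty xr ry; have [//|yx] := gle_total ts tx ty.
  have [->|/eqP xy] := eqVneq x y; first exact: gle_refl.
  have : glt y x by split => // xy'; apply: xy.
  by move=> /(mass_below_lt t) /(lt_le_trans ry) /(lt_trans xr); rewrite ltxx.
(* A staying [v] lies in the interval from [x] to [h] and below [up x], hence below [nudge h x],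
   which in turn is below [up x] and so below [up v]. *)
have stay_move v x : t v != 0 -> t x != 0 -> mass_below t x < r ->
    r < mass_below t v + t v -> gle v (nudge h x) /\ gle (nudge h x) (up v).
  move=> tv tx xr rv; have xv := sep _ _ tx tv xr rv.
  have [_ _ hx max] := nudgeP (th _ tx); split.
    by apply: max => //; [exact: th|exact: gle_up_simplex ts tv tx].
  exact: gle_trans hx (up_mono xv).
(* Since [nudge h x] is below [up x], it suffices that [x] is below [nudge h y]. This follows from
   [x] below [y], or else from maximality. *)
have move_move x y : t x != 0 -> t y != 0 ->
    gle (nudge h x) (up (nudge h y)).
  move=> tx ty; have [_ _ hx _] := nudgeP (th _ tx).
  apply: gle_trans hx (up_mono _).
  have [yy _ _ max] := nudgeP (th _ ty).
  have [xy|yx] := gle_total ts tx ty; first exact: gle_trans yy.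
  by apply: max => //; [exact: th|exact: gle_up_simplex ts tx ty].
split.
- apply: (@sub_finite_set _ _ (carrier t `|` nudge h @` carrier t)).
    move=> v /carrier_push[[tv _]|[x [-> tx _]]]; first by left.
    by right; exists x.
  by rewrite finite_setU; split=> //; exact: finite_image.
- apply/set0P; apply: contraPneq (push_coord_sum h t r) => s0.
  rewrite fsbig1 => [/eqP|v _]; first by rewrite eq_sym oner_eq0.
  apply: contrapT => /eqP n0.
  by have : [set v | push_coord h t r v != 0] v by []; rewrite s0.
- move=> v w /carrier_push[[tv rv]|[x [-> tx xr]]]
    /carrier_push[[tw rw]|[y [-> ty yr]]].
  + by have [_ _] := ts; exact.
  + by left; exact: stay_move.
  + by right; exact: stay_move.
  + have [xy|yx] := gle_total ts tx ty.
      by left; split; [apply: nudge_mono => //; exact: th|exact: move_move].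
    by right; split; [apply: nudge_mono => //; exact: th|exact: move_move].
Qed.

(** The identity is a default for points not supported below [h], where the pushed coordinates need
    not span a simplex. *)
Definition push h (z : RX * R) : RX :=
  if pselect (carrier z.1 `<=` below h) is left th
  then Realization (push_coord_ge0 h z.1 z.2) (push_simplex z.2 th)
         (push_coord_sum h z.1 z.2)
  else z.1.

Lemma push_coordE h t r v : carrier t `<=` below h ->
  push h (t, r) v = push_coord h t r v.
Proof. by move=> th; rewrite /push; case: pselect. Qed.

Lemma push_carrier h t r : carrier t `<=` below h ->
  carrier (push h (t, r)) `<=` carrier t `|` nudge h @` carrier t.
Proof.
move=> th v; rewrite /carrier /= push_coordE//.
by move=> /carrier_push[[tv _]|[x [-> tx _]]]; [left|right; exists x].
Qed.

Lemma push_carrier_ge1 h t r : carrier t `<=` below h -> 1 <= r ->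
  carrier (push h (t, r)) `<=` nudge h @` carrier t.
Proof.
move=> th r1 v; rewrite /carrier /= push_coordE//.
move=> /carrier_push[[tv]|[x [-> tx _]]]; last by exists x.
by move=> /(le_lt_trans r1); rewrite ltNge mass_below_le1.
Qed.

Lemma push_stable h t r : closed_simplex (below h) t ->
  closed_simplex (below h) (push h (t, r)).
Proof.
move=> th v /(push_carrier th)[/th//|[x /th xh <-]].
by have [] := nudgeP xh.
Qed.

Lemma push_le0 h t r : closed_simplex (below h) t -> r <= 0 ->
  push h (t, r) = t.
Proof.
move=> th r0; apply: realization_eq => v.
rewrite push_coordE// /push_coord shifted_le0// subr0 fsbig1 ?addr0// => x _.
by rewrite shifted_le0// if_same.
Qed.

Lemma push_continuous h :
  continuous_on (closed_simplex (below h)) (push h).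
Proof.
apply: continuous_on_closed_simplex => s ss sbelow t r st.
have fs := simplex_finite ss; pose A := fset_set s.
have sA (u : RX) : carrier u `<=` s -> carrier u `<=` [set` A].
  by rewrite fset_setK.
(* On the closed simplex of [s] every sum runs over the fixed finite set [A], which gives coordinate
   formulas that are continuous everywhere. *)
pose lo x (u : RX) : R := \sum_(y <- A) if `[< glt y x >] then u y else 0.
pose sh x (z : RX * R) : R :=
  Num.min z.2 (lo x z.1 + z.1 x) - Num.min z.2 (lo x z.1).
pose co v (z : RX * R) : R := z.1 v - sh v z +
  \sum_(x <- A) if nudge h x == v then sh x z else 0.
have coE v (u : RX) r' : carrier u `<=` s -> push h (u, r') v = co v (u, r').
  move=> us; rewrite push_coordE; last by move=> x /us /sbelow.
  rewrite /push_coord (fsum_shiftedE _ _ _ (sA _ us)) /shifted.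
  by rewrite !(mass_belowE _ (sA _ us)); congr (_ + _); apply: eq_bigr => x _;
    rewrite !(mass_belowE _ (sA _ us)).
have coord1 v : continuous (fun z : RX * R => z.1 v).
  move=> z; apply: (@continuous_comp _ _ _ fst (fun u : RX => u v)).
    exact: cvg_fst.
  exact: coord_continuous.
have lo1 x : continuous (fun z : RX * R => lo x z.1).
  apply: continuous_big => [|y _]; first exact: add_continuous.
  by case: (`[< glt y x >]) => //; exact: cst_continuous.
have shc x : continuous (sh x).
  move=> z; apply: cvgB.
    apply: continuous_min; first exact: cvg_snd.
    by apply: cvgD; [exact: lo1|exact: coord1].
  by apply: continuous_min; [exact: cvg_snd|exact: lo1].
have coc v : continuous (co v).
  move=> z; apply: cvgD; first by apply: cvgB; [exact: coord1|exact: shc].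
  move: z; apply: continuous_big => [|y _]; first exact: add_continuous.
  by case: (nudge h y == v) => //; exact: cst_continuous.
have fV : finite_set (s `|` nudge h @` s).
  by rewrite finite_setU; split=> //; exact: finite_image.
apply: (cvg_realization _ fV).
- apply: filterS (near_within_fst _ _ _) => -[u r'] /= us v.
  move=> /push_carrier [x /us /sbelow//|/us ?|[x /us ? <-]]; first by left.
  by right; exists x.
- move=> v; rewrite coE// => B.
  move=> /(continuous_continuous_on (A := closed_simplex s) (coc v) st).
  apply: filterS2 (near_within_fst (closed_simplex s) t r) => -[u r'] /= us.
  by rewrite coE.
Qed.
End Push.

Section Sweep.
Local Open Scope ring_scope.
Variables (R : realType) (P : garside_poset).
Local Notation X := (gcomplex P).
Local Notation RX := (realization R X).
Implicit Types (t u : RX) (x y h v : X) (r : R).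

Definition vertex_coord v x : R := if x == v then 1 else 0.

Lemma vertex_coord_ge0 v x : 0 <= vertex_coord v x.
Proof. by rewrite /vertex_coord; case: ifP. Qed.

Lemma vertex_coord_simplex v : @simplex X (carrier (vertex_coord v)).
Proof.
rewrite (_ : carrier _ = [set v]); first exact: simplex_vertex.
apply/seteqP; split => x; rewrite /carrier /vertex_coord /=.
  by case: (x =P v) => [->//|_] /eqP.
by move=> ->; rewrite eqxx oner_eq0.
Qed.

Lemma vertex_coord_sum v : \sum_(x \in [set: X]) vertex_coord v x = 1.
Proof.
rewrite (fsbigTE [fset v]%fset) ?big_seq_fset1 /vertex_coord ?eqxx// => x.
by rewrite inE => /negPf ->.
Qed.

Definition vertex_point v : RX :=
  Realization (vertex_coord_ge0 v) (vertex_coord_simplex v) (vertex_coord_sum v).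

Lemma carrier_vertex_point v : carrier (vertex_point v) `<=` [set v].
Proof.
move=> x; rewrite /carrier /= /vertex_coord.
by case: (x =P v) => [->//|_] /eqP.
Qed.

Lemma vertex_pointP t v : carrier t `<=` [set v] -> t = vertex_point v.
Proof.
move=> tv; have := @coord_sumE _ _ [fset v]%fset t.
rewrite big_seq_fset1 => tv1; apply: realization_eq => x.
rewrite /= /vertex_coord; case: eqP => [->|xv].
  by apply: tv1 => y /tv ->; rewrite /= inE.
by apply/eqP; apply: contra_notT xv => /tv.
Qed.

(** A new push starts at every integer time; each is complete after one unit of time and constant
    from then on. *)
Definition sweep h := concat (fun=> @push R P h).

Lemma sweep_stable h t r : closed_simplex (below h) t ->
  closed_simplex (below h) (sweep h (t, r)).
Proof. by apply: concat_stable => _; exact: push_stable. Qed.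

Lemma sweep_le0 h t r : closed_simplex (below h) t -> r <= 0 ->
  sweep h (t, r) = t.
Proof.
apply: concat_le0 => _; [exact: push_le0|exact: push_stable].
Qed.

Lemma sweep_continuous h : continuous_on (closed_simplex (below h)) (sweep h).
Proof.
apply: concat_continuous => _.
- exact: push_le0.
- exact: push_stable.
- exact: push_continuous.
Qed.

Lemma sweep_top h t r : closed_simplex (below h) t -> 0 <= r ->
  (forall v, carrier t v -> (height h v)%:R <= r) ->
  sweep h (t, r) = vertex_point h.
Proof.
move=> th r0 ht; apply: vertex_pointP; rewrite /sweep /concat /=.
set n := Num.trunc r; set f := fun=> push h.
have nr : n%:R <= r by rewrite truncn_le.
have fh k : closed_simplex (below h) (stages f k (t, r)).
  exact: (stages_stable (fun=> @push_stable R P h) k r th).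
(* The last stage, of index [n], may still be running, but it fixes the vertex [h]. *)
suff fn : carrier (stages f n (t, r)) `<=` [set h].
  have := push_carrier (r := r - n%:R) (fh n).
  by move=> sub v /sub[/fn//|[x /fn -> <-]]; exact: nudge_top.
have {}fn : carrier (stages f n (t, r)) `<=` iter n (nudge h) @` carrier t.
  (* Stage [k] has run for time [r - k], at least 1, so all mass has been nudged once more. *)
  elim: n nr => [_ v tv|k IH kr]; first by exists v.
  move=> v /(push_carrier_ge1 (fh k)) -[].
    by rewrite lerBrDr -natr1 addrC in kr *.
  have kr' : k%:R <= r by apply: le_trans kr; rewrite ler_nat.
  by move=> x /(IH kr')[y ty <-] <-; exists y.
move=> v /fn[x tx <-]; apply: heightP; first exact: th.
by rewrite truncn_ge_nat// ht.
Qed.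
End Sweep.

Section WeightedSum.
Local Open Scope ring_scope.
Variables (R : realType) (X : simplicial_complex) (w : X -> R).
Local Notation RX := (realization R X).

(** The extension of [w] from the vertices to the realization that is affine on each closed
    simplex. *)
Definition weighted_sum (t : RX) : R := \sum_(x \in [set: X]) t x * w x.

Implicit Types t : RX.

Lemma weighted_sumE (A : {fset X}) t : carrier t `<=` [set` A] ->
  weighted_sum t = \sum_(x <- A) t x * w x.
Proof.
move=> tA; apply: fsbigTE => x xA.
suff -> : t x = 0 by rewrite mul0r.
by apply/eqP; apply: contraNT xA => /tA.
Qed.

Lemma carrier_fset_set t : carrier t `<=` [set` fset_set (carrier t)].
Proof. by rewrite fset_setK//; exact: simplex_finite (coord_carrier t). Qed.

Lemma weighted_sum_ge t (c : R) : (forall x, carrier t x -> c <= w x) ->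
  c <= weighted_sum t.
Proof.
move=> cw; have tA := @carrier_fset_set t; rewrite (weighted_sumE tA).
rewrite -[c]mul1r -(coord_sumE tA) mulr_suml; apply: ler_sum => x _.
have [->|tx] := eqVneq (t x) 0; first by rewrite !mul0r.
by apply: ler_wpM2l; [exact: coord_ge0|exact: cw].
Qed.

Lemma weighted_sum_eq0 t : (forall x, carrier t x -> w x = 0) ->
  weighted_sum t = 0.
Proof.
move=> w0; apply: fsbig1 => x _.
have [->|tx] := eqVneq (t x) 0; first by rewrite mul0r.
by rewrite w0// mulr0.
Qed.

Lemma closed_simplexT : closed_simplex [set: X] = [set: RX].
Proof. by apply/seteqP; split=> // t _ v. Qed.

Lemma weighted_sum_continuous : continuous (fun z : RX * R => weighted_sum z.1).
Proof.
apply/continuous_onT; rewrite -closed_simplexT.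
apply: continuous_on_closed_simplex => s ss _.
pose A := fset_set s.
apply: (@continuous_on_eq _ _ _ _ (fun z : RX * R => \sum_(x <- A) z.1 x * w x)).
  move=> t r st; rewrite -weighted_sumE// /A fset_setK//.
  exact: simplex_finite ss.
apply: continuous_continuous_on; apply: continuous_big => [|x _].
  exact: add_continuous.
move=> z; apply: cvgM; last exact: cvg_cst.
apply: (@continuous_comp _ _ _ fst (fun u : RX => u x)); first exact: cvg_fst.
exact: coord_continuous.
Qed.

End WeightedSum.

Lemma continuous_glue (R : realType) (T U : topologicalType) (f g : T -> U)
    (c : T -> R) : continuous f -> continuous g -> continuous c ->
  (forall z, c z = 0%R -> f z = g z) ->
  continuous (fun z => if (c z <= 0)%R then f z else g z).
Proof.
move=> cf cg cc fg z V /=; case: (ltgtP (c z) 0%R) => cz.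
- have lt0 : \forall u \near z, (c u < 0)%R.
    apply: (cc z [set x | x < 0]%R); apply: open_nbhs_nbhs; split => //.
  by move=> /(cf z) /=; apply: filterS2 lt0 => u /ltW /= ->.
- have gt0 : \forall u \near z, (0 < c u)%R.
    apply: (cc z [set x | 0 < x]%R); apply: open_nbhs_nbhs; split => //.
  by move=> /(cg z) /=; apply: filterS2 gt0 => u; rewrite ltNge => /negPf /= ->.
- move=> fV; have gV : nbhs (g z) V by rewrite -fg.
  have fz : \forall u \near z, V (f u) by exact: cf.
  have gz : \forall u \near z, V (g u) by exact: cg.
  by apply: filterS2 fz gz => u /=; case: ifP.
Qed.

(** * Assembling the contractions onto the elements of the cofinal sequence *)

Section Contraction.
Local Open Scope ring_scope.
Variables (R : realType) (P : garside_poset) (b : P).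
Local Notation X := (gcomplex P).
Local Notation RX := (realization R X).
Implicit Types (t u : RX) (x y h v : X) (r : R).

Local Notation B n := (iter n up b).

(** The successor absorbs the difference of heights within a simplex: if the whole carrier is below
    [B n], the weighted sum bounds the height of each vertex, and unit time suffices to reach
    [B n.+1]. *)
Definition cutoff n x : R :=
  if `[< gle x (B n) >] then (height (B n.+1) x).+1%:R else 0.

Definition collapse n (z : RX * R) : RX :=
  if pselect (carrier z.1 `<=` below (B n.+1))
  then sweep (B n.+1) (z.1, z.2 * weighted_sum (cutoff n) z.1) else z.1.

Lemma cutoff_ge0 n x : 0 <= cutoff n x.
Proof. by rewrite /cutoff; case: ifP. Qed.

Lemma collapse_le0 n t r : r <= 0 -> collapse n (t, r) = t.
Proof.
move=> r0; rewrite /collapse; case: pselect => // th /=.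
rewrite sweep_le0// mulr_le0_ge0//; apply: weighted_sum_ge => x _.
exact: cutoff_ge0.
Qed.

Lemma collapse_stable n m t r : (n < m)%N -> carrier t `<=` below (B m) ->
  carrier (collapse n (t, r)) `<=` below (B m).
Proof.
move=> nm tm; rewrite /collapse; case: pselect => // th /=.
move=> v /(sweep_stable (r := _) th) vn.
exact: gle_trans vn (le_iter_upW _ nm).
Qed.

Lemma collapse_top n t r : carrier t `<=` below (B n) -> 1 <= r ->
  collapse n (t, r) = vertex_point R (B n.+1 : X).
Proof.
move=> tn r1; have tn1 : carrier t `<=` below (B n.+1).
  by move=> v /tn vn; exact: gle_trans vn (le_iter_upS _ _).
rewrite /collapse; case: pselect => //= _.
have r0 : 0 <= r by exact: le_trans r1.
have w0 : 0 <= weighted_sum (cutoff n) t.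
  by apply: weighted_sum_ge => x _; exact: cutoff_ge0.
apply: sweep_top => //; first exact: mulr_ge0.
move=> v tv; apply: (@le_trans _ _ (weighted_sum (cutoff n) t)); last first.
  by rewrite ler_peMl.
apply: weighted_sum_ge => x tx; have xn : gle x (B n) := tn x tx.
rewrite /cutoff asboolT// ler_nat.
by apply: (height_simplex (coord_carrier t) tv tx); exact: tn1.
Qed.

(** A simplex with a vertex not below [B n.+1] has no vertex below [B n]. There the sweep has speed
    zero and agrees with the default identity. *)
Lemma collapse_continuous n : continuous_on setT (collapse n).
Proof.
rewrite -closed_simplexT; apply: continuous_on_closed_simplex => s ss _.
have [sB|/existsNP[y /not_implyP[sy yB]]] := pselect (s `<=` below (B n.+1)).
  apply: (@continuous_on_eq _ _ _ _ (fun z : RX * R =>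
      sweep (B n.+1) (z.1, z.2 * weighted_sum (cutoff n) z.1))).
    move=> t r st; rewrite /collapse; case: pselect => // -[].
    by move=> v /st /sB.
  apply: (continuous_on_comp (B := closed_simplex (below (B n.+1))) (g := fst)).
  - exact: sweep_continuous.
  - by apply: continuous_continuous_on => z; exact: cvg_fst.
  - by move=> t r st v /st /sB.
  - apply: continuous_continuous_on => z; apply: cvgM; first exact: cvg_snd.
    exact: weighted_sum_continuous.
apply: (@continuous_on_eq _ _ _ _ fst); last first.
  by apply: continuous_continuous_on => z; exact: cvg_fst.
move=> t r st; rewrite /collapse; case: pselect => //= th.
rewrite weighted_sum_eq0 ?mulr0 ?sweep_le0// => x tx.
rewrite /cutoff asboolF// => xB; apply: yB.
exact: gle_trans (gle_up_simplex ss sy (st _ tx)) (up_mono xB).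
Qed.

Definition collapse_all := concat collapse.

Lemma collapse_all_continuous : continuous collapse_all.
Proof.
apply/continuous_onT; apply: concat_continuous => //.
- by move=> n t r _; exact: collapse_le0.
- exact: collapse_continuous.
Qed.

Lemma collapse_all_le0 t r : r <= 0 -> collapse_all (t, r) = t.
Proof.
by apply: (concat_le0 (A := setT)) => // n u s _; exact: collapse_le0.
Qed.

(** By time [m.+1] stage [m] has sent both [t] and [b] to the vertex [B m.+1], and all later stages
    treat them alike. *)
Lemma collapse_all_eventually m t r : carrier t `<=` below (B m) ->
  m.+1%:R <= r ->
  collapse_all (t, r) = collapse_all (vertex_point R (b : X), r).
Proof.
move=> tm mr.
have stable k u : (k <= m)%N -> carrier u `<=` below (B m) ->
    carrier (stages collapse k (u, r)) `<=` below (B m).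
  move=> + um; elim: k => //= k IH km; apply: collapse_stable => //.
  by apply: IH; exact: ltnW.
have top u : carrier u `<=` below (B m) ->
    stages collapse m.+1 (u, r) = vertex_point R (B m.+1 : X).
  move=> um /=; apply: collapse_top; first exact: stable.
  by rewrite lerBrDr -natr1 addrC in mr *.
have bm : carrier (vertex_point R (b : X)) `<=` below (B m).
  move=> v /carrier_vertex_point ->; exact: (@le_iter_upW _ 0).
rewrite /collapse_all /concat -[(t, r).2]/r -[(_, r).2]/r.
have : (m.+1 <= (Num.trunc r).+1)%N.
  by rewrite -(ler_nat R) (le_trans mr)// ltW// truncnS_gt.
move: (Num.trunc r).+1 => n; elim: n => // n IH.
rewrite leq_eqVlt => /orP[/eqP [<-]|/IH /= ->//].
by rewrite !top.
Qed.

Definition level x : nat :=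
  ex_minn (let: ex_intro n xn := cofinal_iter_up b x in
    ex_intro (fun n => `[< gle x (B n) >]) n (introT (asboolP _) xn)).

Lemma levelP x : gle x (B (level x)).
Proof. by rewrite /level; case: ex_minnP => n /asboolP. Qed.

Lemma level_le x n : gle x (B n) -> (level x <= n)%N.
Proof. by rewrite /level; case: ex_minnP => m _ mn /asboolP /mn. Qed.

Lemma level_simplex (s : set P) x y : @simplex X s -> s x -> s y ->
  (level x <= (level y).+1)%N.
Proof.
move=> ss sx sy; apply: level_le.
exact: gle_trans (gle_up_simplex ss sx sy) (up_mono (levelP y)).
Qed.

(** Levels in a simplex differ by at most one. For a vertex [v] the carrier lies below [B m] with
    [m] one more than [level v]; the required time [m.+1] is at most [level x + 3] for each vertex
    [x]. *)
Definition arrival (t : RX) : R :=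
  weighted_sum (fun x : X => (level x + 3)%:R) t.

Lemma collapse_all_arrival t :
  collapse_all (t, arrival t) =
  collapse_all (vertex_point R (b : X), arrival t).
Proof.
have [v tv] := carrier_nonempty t; have ts := coord_carrier t.
apply: (@collapse_all_eventually (level v).+1).
  move=> x tx; apply: gle_trans (levelP x) _; apply: le_iter_upW.
  exact: level_simplex ts tx tv.
apply: weighted_sum_ge => x tx; rewrite ler_nat.
by rewrite addn3 !ltnS; exact: level_simplex ts tv tx.
Qed.

Lemma gcomplex_contractible : contractible R RX.
Proof.
pose c (z : RX * R) : R := z.2 - 2^-1.
(* The first half follows [t] until [arrival t], the second half retraces the trajectory of [b] from
   that time back to 0. At time one half both branches have run for [arrival t]. *)
pose H (z : RX * R) := if c z <= 0
  then collapse_all (z.1, z.2 * 2 * arrival z.1)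
  else collapse_all (vertex_point R (b : X), (1 - z.2) * 2 * arrival z.1).
exists (vertex_point R (b : X)), H; split.
- apply: continuous_subspaceT; apply: continuous_glue.
  + apply/continuous_onT; apply: (continuous_on_comp (B := setT) (g := fst)) => //.
    * by apply/continuous_onT; exact: collapse_all_continuous.
    * by apply/continuous_onT => z; exact: cvg_fst.
    * apply/continuous_onT => z; apply: cvgM; last exact: weighted_sum_continuous.
      by apply: cvgM; [exact: cvg_snd|exact: cvg_cst].
  + apply/continuous_onT; apply: (continuous_on_comp (B := setT)
      (g := fun=> vertex_point R (b : X))) => //.
    * by apply/continuous_onT; exact: collapse_all_continuous.
    * by apply/continuous_onT => z; exact: cvg_cst.
    * apply/continuous_onT => z; apply: cvgM; last exact: weighted_sum_continuous.
      apply: cvgM; last exact: cvg_cst.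
      by apply: cvgB; [exact: cvg_cst|exact: cvg_snd].
  + move=> z; apply: cvgB; [exact: cvg_snd|exact: cvg_cst].
  + move=> [t r] /= /eqP; rewrite subr_eq0 => /eqP /= ->.
    rewrite mulVf ?pnatr_eq0// (_ : (1 - 2^-1) * 2 = 1) ?mul1r.
      exact: collapse_all_arrival.
    by rewrite mulrBl mul1r mulVf ?pnatr_eq0// -[2]/(1 + 1) addrK.
- move=> t; rewrite /H /c /= sub0r oppr_le0 invr_ge0 ler0n !mul0r.
  exact: collapse_all_le0.
- move=> t; rewrite /H /c /= ifF ?subrr ?mul0r ?collapse_all_le0//.
  by apply/negbTE; rewrite -ltNge subr_gt0 invf_lt1 ?ltr0n// ltr1n.
Qed.
End Contraction.

(** * Compactness *)

Section Compactness.
Local Open Scope ring_scope.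
Variables (R : realType) (X : simplicial_complex).
Local Notation RX := (realization R X).

Lemma coord_le1 (t : RX) v : t v <= 1.
Proof.
have ft := simplex_finite (coord_carrier t).
pose A := (v |` fset_set (carrier t))%fset.
have tA : carrier t `<=` [set` A].
  by move=> x tx; rewrite /= !inE in_fset_set// mem_set ?orbT.
rewrite -(coord_sumE tA) (big_fsetD1 v) /=; last by rewrite !inE eqxx.
by rewrite lerDl; apply: sumr_ge0 => x _; exact: coord_ge0.
Qed.

(** Barycentric coordinates embed the closed simplex in a product of compact sets, cut down by the
    closed condition that the sum be 1. A cluster point there is again a point of the simplex, and
    the weak topology on it is pointwise. *)
Lemma compact_closed_simplex (s : set X) : simplex s ->
  compact (closed_simplex s : set RX).
Proof.
move=> ss F PF Fs; have fs := simplex_finite ss; pose A := fset_set s.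
have As : [set` A] = s by rewrite fset_setK.
pose box v : set R := if `[< s v >] then [set` `[0, 1]%R] else [set 0].
pose K := [set f : {ptws X -> R} | forall v, box v (f v)] `&`
  [set f | \sum_(v <- A) f v = 1].
have cK : compact K.
  apply: compact_closedI.
    apply: (@tychonoff _ (fun=> R)) => v; rewrite /box; case: ifP => _.
      exact: segment_compact.
    exact: compact_set1.
  apply: (@closed_comp _ _ (fun f : {ptws X -> R} => \sum_(v <- A) f v) [set 1]).
    move=> f _; move: f; apply: continuous_big => [|v _].
      exact: add_continuous.
    exact: (proj_continuous (K := fun=> R)).
  exact: closed_eq.
pose c (t : RX) : {ptws X -> R} := t.
have GK : (c @ F) K.
  suff : F (c @^-1` K) by [].
  apply: filterS Fs => t st; split=> [v|].
    rewrite /box; case: asboolP => sv.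
      rewrite /= in_itv /=; apply/andP; split; first exact: coord_ge0.
      exact: coord_le1.
    by apply/eqP; apply: contra_notT sv; exact: st.
  by apply: coord_sumE; rewrite As.
have [f [[fbox f1] fcl]] := cK _ (fmap_proper_filter c PF) GK.
have f0 v : 0 <= f v.
  have := fbox v; rewrite /box; case: ifP => _ /=; last by move=> ->.
  by rewrite in_itv/= => /andP[].
have fcar : carrier f `<=` s.
  move=> v fv; apply: contrapT => sv; have := fbox v.
  by rewrite /box asboolF// => /= f0'; move: fv; rewrite /carrier /= f0' eqxx.
have fsum : \sum_(v \in [set: X]) f v = 1.
  rewrite (fsbigTE A)// => v vA; apply/eqP; apply: contraNT vA => /fcar.
  by rewrite -As.
have fsimp : simplex (carrier f).
  apply: (simplex_face ss) => //; apply/set0P; apply: contraPneq fsum => c0.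
  rewrite fsbig1 => [/eqP|v _]; first by rewrite eq_sym oner_eq0.
  by apply: contrapT => /eqP fv; have : carrier f v by []; rewrite c0.
exists (Realization f0 fsimp fsum); split=> // U V FU.
rewrite nbhsE => -[O [oO Of] OV].
rewrite realization_openE in oO; have [W [oW OW]] := oO s ss.
have Wf : W f.
  have : (closed_simplex s `&` O) (Realization f0 fsimp fsum) by [].
  by rewrite OW => -[].
have GU : (c @ F) (c @` (U `&` closed_simplex s)).
  suff : F (c @^-1` (c @` (U `&` closed_simplex s))) by [].
  by apply: filterS (filterI FU Fs) => t Ut; exists t.
have [g [[t [Ut st] <-] Wg]] := fcl _ _ GU (open_nbhs_nbhs (conj oW Wf)).
exists t; split=> //; apply: OV.
have : (closed_simplex s `&` [set t : RX | W (t : X -> R)]) t by [].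
by rewrite -OW => -[].
Qed.

Lemma compact_space_of (K : set (set X)) : subcomplex K -> finite_set K ->
  compact (space_of R K).
Proof.
move=> [Ks Kf] finK.
rewrite (_ : space_of R K = \big[setU/set0]_(s <- fset_set K) closed_simplex s).
  rewrite big_seq; apply: bigsetU_compact => s.
  rewrite in_fset_set// => /set_mem /Ks.
  exact: compact_closed_simplex.
rewrite -bigcup_fset_set//.
apply/seteqP; split=> t /=; first by move=> Kt; exists (carrier t).
move=> [s Ksb ts]; apply: Kf Ksb ts _; exact: carrier_nonempty.
Qed.

End Compactness.

(** * The enveloping groupoid of a right-Ore category *)

Section GroupoidTheory.
Local Open Scope cat_scope.

Lemma groupoid_mulIl (E : groupoid) (x y z : E) (f : mor x y) (g h : mor y z) :
  f * g = f * h -> g = h.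
Proof.
have [f' [_ f'f]] := gcat_inv f => fgh.
by rewrite -(mcomp1m g) -f'f -mcompA fgh mcompA f'f mcomp1m.
Qed.

Lemma groupoid_mulIr (E : groupoid) (x y z : E) (f g : mor x y) (h : mor y z) :
  f * h = g * h -> f = g.
Proof.
have [h' [hh' _]] := gcat_inv h => fgh.
by rewrite -(mcompm1 f) -hh' mcompA fgh -mcompA hh' mcompm1.
Qed.

Lemma functor_eq (C D : category) (o : C -> D)
    (h : forall x y : C, mor x y -> mor (o x) (o y)) p1 p2 q1 q2 :
  @Functor C D o h p1 q1 = @Functor C D o h p2 q2.
Proof. by congr Functor; exact: Prop_irrelevance. Qed.

Lemma functor_eta (C D : category) (F : functor C D) :
  F = @Functor C D (fob F) (@fhom _ _ F) (@fhom1 _ _ F) (@fhomM _ _ F).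
Proof. by case: F. Qed.

Lemma functor_compA (A B C D : category) (F : functor A B) (G : functor B C)
    (H : functor C D) :
  functor_comp F (functor_comp G H) = functor_comp (functor_comp F G) H.
Proof. exact: functor_eq. Qed.

Definition id_functor (C : category) : functor C C :=
  @Functor C C id (fun _ _ => id) (fun=> erefl) (fun _ _ _ _ _ => erefl).

Lemma functor_comp_id (C D : category) (F : functor C D) :
  functor_comp F (id_functor D) = F.
Proof. by case: F => o h p q; exact: functor_eq. Qed.

End GroupoidTheory.

Section Germs.
Local Open Scope cat_scope.
Variables (C : category) (hOre : right_ore C) (w : C).

(* Pulling back along a morphism is bijective on germs of families, two families
   having the same germ when they agree on a principal right ideal.  So C maps to
   a groupoid, faithfully because C is cancellative, and hence embeds into its
   enveloping groupoid. *)
Definition family (x : C) := forall z, mor x z -> mor w z -> Prop.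

Definition germ_eq x (p q : family x) := exists z (h : mor x z),
  forall t (k : mor z t), p t (h * k) = q t (h * k).

Definition pull x y (f : mor x y) (p : family x) : family y :=
  fun z g => p z (f * g).

Lemma germ_eq_refl x (p : family x) : germ_eq p p.
Proof. by exists x, (idm x). Qed.

Lemma germ_eq_sym x (p q : family x) : germ_eq p q -> germ_eq q p.
Proof. by move=> [z [h hpq]]; exists z, h => t k; rewrite hpq. Qed.

Lemma germ_eq_trans x (p q r : family x) :
  germ_eq p q -> germ_eq q r -> germ_eq p r.
Proof.
have [_ _ ore] := hOre; move=> [z [h pq]] [z' [h' qr]].
have [t [k [k' hk]]] := ore _ _ _ h h'.
by exists t, (h * k) => s l; rewrite -mcompA pq mcompA hk -mcompA qr.
Qed.

Lemma pull_germ x y (f : mor x y) (p q : family x) :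
  germ_eq p q <-> germ_eq (pull f p) (pull f q).
Proof.
have [_ _ ore] := hOre; split=> -[z [h pq]].
  have [t [k [k' hk]]] := ore _ _ _ f h.
  by exists t, k => s l; rewrite /pull mcompA hk -mcompA pq.
by exists z, (f * h) => t k; rewrite -mcompA; exact: pq.
Qed.

(** The witness transplants [q] to the multiples of [f] and is false elsewhere; left cancellation
    recovers [g] from [f * g]. *)
Lemma pull_surj x y (f : mor x y) (q : family y) :
  exists p : family x, pull f p = q.
Proof.
have [lc _ _] := hOre.
exists (fun z m a => exists2 g : mor y z, m = f * g & q z g a).
apply: functional_extensionality_dep => z; apply/funext => g.
apply/funext => a; apply/propext.
by split=> [[g' /lc <-]|qga] //; exists g.
Qed.

Lemma pull1 x (p : family x) : pull (idm x) p = p.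
Proof.
apply: functional_extensionality_dep => z; apply/funext => g.
by rewrite /pull mcomp1m.
Qed.

Lemma pullM x y z (f : mor x y) (g : mor y z) (p : family x) :
  pull (f * g) p = pull g (pull f p).
Proof.
apply: functional_extensionality_dep => t; apply/funext => h.
by rewrite /pull mcompA.
Qed.

Definition germ_rel x y := family x -> family y -> Prop.

Definition rel_comp x y z (r : germ_rel x y) (s : germ_rel y z) : germ_rel x z :=
  fun p q => exists2 m, r p m & s m q.

Lemma rel_compA x y z t (a : germ_rel x y) (b : germ_rel y z) (c : germ_rel z t) :
  rel_comp a (rel_comp b c) = rel_comp (rel_comp a b) c.
Proof.
apply/funext => p; apply/funext => q; apply/propext; split.
  by move=> [m apm [n bmn cnq]]; exists n => //; exists m.
by move=> [n [m apm bmn] cnq]; exists m => //; exists n.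
Qed.

(* A bijection between families up to germ_eq, as a saturated relation; this
   spares the quotient. *)
Definition germ_inverse x y (r : germ_rel x y) (s : germ_rel y x) :=
  [/\ rel_comp (@germ_eq x) r = r, rel_comp r (@germ_eq y) = r,
      rel_comp (@germ_eq y) s = s, rel_comp s (@germ_eq x) = s &
      rel_comp r s = @germ_eq x /\ rel_comp s r = @germ_eq y].

Definition germ_bij x y := {r : germ_rel x y | exists s, germ_inverse r s}.

Lemma germ_bij_inj x y (r s : germ_bij x y) : sval r = sval s -> r = s.
Proof.
case: r s => r hr [s hs] /= rs; subst s.
by congr exist; exact: Prop_irrelevance.
Qed.

Lemma germ_inverse1 x : germ_inverse (@germ_eq x) (@germ_eq x).
Proof.
have e : rel_comp (@germ_eq x) (@germ_eq x) = @germ_eq x.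
  apply/funext => p; apply/funext => q; apply/propext; split.
    by move=> [m]; exact: germ_eq_trans.
  by move=> pq; exists p => //; exact: germ_eq_refl.
by split.
Qed.

Lemma germ_inverseM x y z (r : germ_rel x y) r' (s : germ_rel y z) s' :
  germ_inverse r r' -> germ_inverse s s' ->
  germ_inverse (rel_comp r s) (rel_comp s' r').
Proof.
move=> [r1 r2 r3 r4 [r5 r6]] [s1 s2 s3 s4 [s5 s6]]; split; last split.
- by rewrite rel_compA r1.
- by rewrite -rel_compA s2.
- by rewrite rel_compA s3.
- by rewrite -rel_compA r4.
- by rewrite -rel_compA (rel_compA s) s5 r3.
- by rewrite -rel_compA (rel_compA r') r6 s1.
Qed.

Lemma germ_bijM x y z (r : germ_bij x y) (s : germ_bij y z) :
  exists t, germ_inverse (rel_comp (sval r) (sval s)) t.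
Proof.
have [r' hr] := svalP r; have [s' hs] := svalP s.
by exists (rel_comp s' r'); exact: germ_inverseM.
Qed.

Definition germ_category : category.
refine (@Category C germ_bij
  (fun x => exist _ (@germ_eq x) (ex_intro _ _ (germ_inverse1 x)))
  (fun x y z r s => exist _ (rel_comp (sval r) (sval s)) (germ_bijM r s)) _ _ _).
- by move=> x y r; apply: germ_bij_inj; have [r' []] := svalP r.
- by move=> x y r; apply: germ_bij_inj; have [r' []] := svalP r.
- by move=> x y z t r s u; apply: germ_bij_inj; exact: rel_compA.
Defined.

Lemma germ_category_inv (x y : germ_category) (f : mor x y) : invertible f.
Proof.
case: f => r [s [r1 r2 r3 r4 [r5 r6]]].
have hs : exists u, germ_inverse s u by exists r.
by exists (exist _ s hs); split; apply: germ_bij_inj.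
Qed.

Definition germ_groupoid : groupoid := Groupoid germ_category_inv.

Definition pull_rel x y (f : mor x y) : germ_rel x y :=
  fun p q => germ_eq (pull f p) q.

(** Well-definedness and injectivity on germs come from [pull_germ], surjectivity from
    [pull_surj]. *)
Lemma pull_rel_inverse x y (f : mor x y) :
  germ_inverse (pull_rel f) (fun q p => pull_rel f p q).
Proof.
split; last split; apply/funext => p; apply/funext => q; apply/propext; split.
- move=> [m /(pull_germ f) pm mq]; exact: germ_eq_trans pm mq.
- by move=> pq; exists p => //; exact: germ_eq_refl.
- by move=> [m pm mq]; exact: germ_eq_trans pm mq.
- by move=> pq; exists q => //; exact: germ_eq_refl.
- by move=> [m pm mq]; apply: germ_eq_trans mq _; exact: germ_eq_sym.
- by move=> pq; exists p => //; exact: germ_eq_refl.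
- by move=> [m pm /(pull_germ f) mq]; apply: germ_eq_trans pm; exact: germ_eq_sym.
- by move=> pq; exists q => //; exact: germ_eq_refl.
- move=> [m pm qm]; apply/(pull_germ f); apply: germ_eq_trans pm _.
  exact: germ_eq_sym.
- move=> /(pull_germ f) pq; exists (pull f p); first exact: germ_eq_refl.
  exact: germ_eq_sym.
- by move=> [m mp mq]; apply: germ_eq_trans mq; exact: germ_eq_sym.
- have [m <-] := pull_surj f p => pq; exists m => //; exact: germ_eq_refl.
Qed.

Definition germ_functor : functor C germ_groupoid.
refine (@Functor C germ_groupoid id (fun x y f =>
  exist _ (pull_rel f) (ex_intro _ _ (pull_rel_inverse f))) _ _).
- move=> x; apply: germ_bij_inj; apply/funext => p; apply/funext => q /=.
  by rewrite /pull_rel pull1.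
- move=> x y z f g; apply: germ_bij_inj; apply/funext => p; apply/funext => q /=.
  rewrite /pull_rel pullM; apply/propext; split.
    by move=> pq; exists (pull f p) => //; exact: germ_eq_refl.
  by move=> [m /(pull_germ g) pm mq]; exact: germ_eq_trans pm mq.
Defined.

Lemma germ_functor_faithful y (f g : mor w y) :
  fhom germ_functor f = fhom germ_functor g -> f = g.
Proof.
have [_ rc _] := hOre; move=> /(congr1 sval) /= fg.
(* Families take values in predicates on [mor w z] to make room for this one, the diagonal:
   agreement of its two pullbacks on a multiple [h] forces [f * h = g * h]. *)
pose p0 : family w := fun z m => eq m.
have : pull_rel g p0 (pull f p0) by rewrite -fg; exact: germ_eq_refl.
move=> [z [h /(_ z (idm z))]]; rewrite /pull mcompm1 /p0 => gf.
by apply: (rc _ _ _ _ _ h); move: (congr1 (fun q => q (g * h)) gf) => /= <-.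
Qed.

End Germs.

(** * Calculus of fractions *)

Section EnvelopingGroupoid.
Local Open Scope cat_scope.
Variables (C : category) (hOre : right_ore C).
Variables (E : groupoid) (iota : functor C E) (hE : enveloping_groupoid iota).

(** The germ functor at [x] is faithful on morphisms with target [x] and factors through [iota]. *)
Lemma iota_faithful (x y : C) (f g : mor x y) :
  fhom iota f = fhom iota g -> f = g.
Proof.
have [F [FE _]] := hE (germ_functor hOre x) => fg.
apply: (germ_functor_faithful (hOre := hOre)); rewrite -FE /=.
by rewrite fg.
Qed.

Definition fractional (x y : C) (f : mor (iota x) (iota y)) :=
  exists z (a : mor x z) (b : mor y z), f * fhom iota b = fhom iota a.

Definition fraction (x y : C) := {f : mor (iota x) (iota y) | fractional f}.

Lemma fraction_inj x y (f g : fraction x y) : sval f = sval g -> f = g.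
Proof.
case: f g => f hf [g hg] /= fg; subst g.
by congr exist; exact: Prop_irrelevance.
Qed.

Lemma fractional_iota x y (f : mor x y) : fractional (fhom iota f).
Proof. by exists y, f, (idm y); rewrite fhom1 mcompm1. Qed.

Lemma fractional1 x : fractional (idm (iota x)).
Proof. by rewrite -fhom1; exact: fractional_iota. Qed.

Lemma fractionalM x y z (f : fraction x y) (g : fraction y z) :
  fractional (sval f * sval g).
Proof.
have [_ _ ore] := hOre.
have [t [a [b fab]]] := svalP f; have [t' [a' [b' gab]]] := svalP g.
(* The Ore condition rewrites the inverse of [b] times [a'] as [c] times the inverse of [c']. *)
have [u [c [c' bc]]] := ore _ _ _ b a'.
exists u, (a * c), (b' * c'); rewrite !fhomM -fab -!mcompA; congr (_ * _).
by rewrite mcompA gab -!fhomM bc.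
Qed.

Lemma fractionalV x y (f : fraction x y) :
  exists g : fraction y x, inverse_of (sval f) (sval g).
Proof.
have [g fg] := gcat_inv (sval f); have [z [a [b fab]]] := svalP f.
suff hg : fractional g by exists (exist _ g hg).
exists z, b, a; case: fg => fg gf.
by rewrite -fab mcompA gf mcomp1m.
Qed.

Definition fraction_category : category.
refine (@Category C fraction
  (fun x => exist _ (idm (iota x)) (fractional1 x))
  (fun x y z f g => exist _ (sval f * sval g) (fractionalM f g)) _ _ _).
- by move=> x y f; apply: fraction_inj; exact: mcomp1m.
- by move=> x y f; apply: fraction_inj; exact: mcompm1.
- by move=> x y z t f g h; apply: fraction_inj; exact: mcompA.
Defined.

Lemma fraction_category_inv (x y : fraction_category) (f : mor x y) :
  invertible f.
Proof.
have [g [fg gf]] := fractionalV f.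
by exists g; split; apply: fraction_inj.
Qed.

Definition fraction_groupoid : groupoid := Groupoid fraction_category_inv.

Definition to_fraction : functor C fraction_groupoid.
refine (@Functor C fraction_groupoid id
  (fun x y f => exist _ (fhom iota f) (fractional_iota f)) _ _).
- by move=> x; apply: fraction_inj; exact: fhom1.
- by move=> x y z f g; apply: fraction_inj; exact: fhomM.
Defined.

Definition of_fraction : functor fraction_groupoid E :=
  @Functor fraction_groupoid E (fob iota) (fun x y f => sval f)
    (fun=> erefl) (fun _ _ _ _ _ => erefl).

Lemma to_of_fraction : functor_comp to_fraction of_fraction = iota.
Proof.
rewrite [RHS]functor_eta; exact: functor_eq.
Qed.

(** Ranging over arbitrary objects of [E] lets the property be carried along an equality of
    functors. *)
Inductive is_fraction : forall u v : E, mor u v -> Prop :=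
  IsFraction x y (f : mor (iota x) (iota y)) : fractional f -> is_fraction f.

Definition transport (u v u' v' : E) (eu : u = u') (ev : v = v') (f : mor u v) :
    mor u' v' :=
  match eu in _ = a, ev in _ = b return mor a b with erefl, erefl => f end.

Lemma iota_fractional (x y : C) (f : mor (iota x) (iota y)) : fractional f.
Proof.
have [F [FE _]] := hE to_fraction.
(* [to_fraction] is the identity on objects and factors through [iota]. *)
have iota_inj (u v : C) : iota u = iota v -> u = v.
  move=> uv; have : fob (functor_comp iota F) u = fob (functor_comp iota F) v.
    by rewrite /= uv.
  by rewrite FE.
(* Both functors restrict to [iota] along [iota], so uniqueness identifies them, and every morphism
   of [E] is a fraction. *)
have id_eq : functor_comp F of_fraction = id_functor E.
  have [G [_ uniq]] := hE iota.
  rewrite -(uniq (functor_comp F of_fraction)).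
    by apply: uniq; exact: functor_comp_id.
  by rewrite functor_compA FE; exact: to_of_fraction.
have frac u v (g : mor u v) : is_fraction g.
  have : is_fraction (fhom (functor_comp F of_fraction) g).
    by apply: IsFraction => /=; exact: svalP.
  by rewrite id_eq.
have trans u v (g : mor u v) : is_fraction g ->
    forall (eu : u = iota x) (ev : v = iota y), fractional (transport eu ev g).
  case=> x' y' h fh eu ev.
  have ex := iota_inj _ _ eu; have ey := iota_inj _ _ ev; subst x' y'.
  by rewrite (Prop_irrelevance eu erefl) (Prop_irrelevance ev erefl).
exact: (trans _ _ f (frac _ _ f) erefl erefl).
Qed.

End EnvelopingGroupoid.

(** * The poset of cosets *)

Section GarsideMap.
Local Open Scope cat_scope.
Variable C : category.
Variables (delta : C -> C) (Delta : forall x : C, mor x (delta x)).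
Hypothesis hDelta : right_garside Delta.

(** If [c] divides [Delta x] with complement [h], then [h] is a right-factor of [Delta x], hence a
    left-factor of [Delta y]. The property passes to products, and divisors generate. This makes
    [up] monotone. *)
Lemma Delta_natural (x y : C) (c : mor x y) :
  exists k, c * Delta y = Delta x * k.
Proof.
have [gen coD _] := hDelta.
elim: c / (gen _ _ c) => {x y} [x|x y c [h ch]|x y z f g _ [k fk] _ [l gl]].
- by exists (idm _); rewrite mcomp1m mcompm1.
- have [k hk] := coD _ _ _ (CoDiv ch).
  by exists k; rewrite -ch -mcompA hk.
- by exists (k * l); rewrite -mcompA gl mcompA fk -mcompA.
Qed.

End GarsideMap.

Section CosetPoset.
Local Open Scope cat_scope.
Variables (C : category) (hOre : right_ore C).
Variables (delta : C -> C) (Delta : forall x : C, mor x (delta x)).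
Hypothesis hDelta : right_garside Delta.
Variables (E : groupoid) (iota : functor C E) (hE : enveloping_groupoid iota).
Variable pt : C.

Record point := Point { base : C; arrow : mor (iota pt) (iota base) }.
Implicit Types p q r : point.

Definition divides p q :=
  exists c : mor (base p) (base q), arrow p * fhom iota c = arrow q.

Lemma divides_refl p : divides p p.
Proof. by exists (idm _); rewrite fhom1 mcompm1. Qed.

Lemma divides_trans p q r : divides p q -> divides q r -> divides p r.
Proof. by move=> [c pq] [d qr]; exists (c * d); rewrite fhomM mcompA pq. Qed.

Definition coset_of p : set point := [set q | divides p q /\ divides q p]%classic.

(* The cosets f C^x of invertibles of C with f in E(pt, -). *)
Definition vcoset := {A : set point | exists p, A = coset_of p}.

HB.instance Definition _ := gen_eqMixin vcoset.
HB.instance Definition _ := gen_choiceMixin vcoset.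

Lemma vcoset_inj (A B : vcoset) : sval A = sval B -> A = B.
Proof.
case: A B => A hA [B hB] /= AB; subst B.
by congr exist; exact: Prop_irrelevance.
Qed.

Definition coset p : vcoset := exist _ (coset_of p) (ex_intro _ p erefl).

Lemma coset_surj (A : vcoset) : exists p, A = coset p.
Proof. by have [p Ap] := svalP A; exists p; exact: vcoset_inj. Qed.

Lemma cosetP p q : coset p = coset q <-> divides p q /\ divides q p.
Proof.
split=> [/(congr1 sval) /= pq|[pq qp]].
  suff : coset_of p q by [].
  by rewrite pq; split; exact: divides_refl.
apply: vcoset_inj; apply/seteqP; split=> r [h1 h2]; split.
- exact: divides_trans h1.
- exact: divides_trans h2 _.
- exact: divides_trans h1.
- exact: divides_trans h2 _.
Qed.

Definition repr (A : vcoset) : point := sval (cid (coset_surj A)).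

Lemma reprK A : coset (repr A) = A.
Proof. by rewrite /repr; case: cid. Qed.

Lemma repr_divides p : divides (repr (coset p)) p /\ divides p (repr (coset p)).
Proof. by apply/cosetP; rewrite reprK. Qed.

Definition vle (A B : vcoset) := divides (repr A) (repr B).

Lemma vleE p q : vle (coset p) (coset q) <-> divides p q.
Proof.
have [p1 p2] := repr_divides p; have [q1 q2] := repr_divides q.
split=> [h|h]; first exact: divides_trans p2 (divides_trans h q1).
exact: divides_trans p1 (divides_trans h q2).
Qed.

Definition point_up p : point :=
  @Point (delta (base p)) (arrow p * fhom iota (Delta (base p))).

Lemma point_up_mono p q : divides p q -> divides (point_up p) (point_up q).
Proof.
move=> [c pq]; have [k ck] := Delta_natural hDelta c.
by exists k; rewrite /= -pq -!mcompA -!fhomM ck.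
Qed.

Definition vup (A : vcoset) : vcoset := coset (point_up (repr A)).

Lemma vupE p : vup (coset p) = coset (point_up p).
Proof.
by have [p1 p2] := repr_divides p; apply/cosetP; split; exact: point_up_mono.
Qed.

(* Cancelling f turns relations between points into relations in C. *)
Lemma divides_cancel p y z (c : mor (base p) y) (d : mor (base p) z) :
  divides (Point (arrow p * fhom iota c)) (Point (arrow p * fhom iota d)) <->
  left_factor c d.
Proof.
split=> [[e /= pe]|[e <-]]; exists e; last by rewrite /= fhomM mcompA.
apply: (iota_faithful hOre hE).
by move: pe; rewrite fhomM -mcompA => /groupoid_mulIl.
Qed.

Lemma vle_ind (Q : vcoset -> vcoset -> Prop) : (forall x, Q x x) ->
  (forall x y z, vle x y -> vle y (vup x) -> Q y z -> Q x z) ->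
  forall x y, vle x y -> Q x y.
Proof.
move=> Q0 Q1 A B; have [p ->] := coset_surj A; have [q ->] := coset_surj B.
move=> /vleE; case: p q => x f [y g] [/= c <-].
have [gen _ _] := hDelta.
(* With [D] arbitrary, a product of divisors is peeled off factor by factor; a single divisor of
   Delta is an elementary step. *)
suff key D : Q (coset (Point (f * fhom iota c))) D -> Q (coset (Point f)) D.
  exact: key.
elim: c / (gen _ _ c) f D => {x y A B g} [x|x y c cd|x y z c d _ IHc _ IHd] f D.
- by rewrite fhom1 mcompm1.
- apply: Q1; first by apply/vleE; exists c.
  by rewrite vupE; apply/vleE/(@divides_cancel (Point f)).
- by rewrite fhomM mcompA => /IHd /IHc.
Qed.

Lemma vle_meet (A H : vcoset) : vle A H -> exists B,
  [/\ vle A B, vle B H, vle B (vup A) &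
      forall Y, vle A Y -> vle Y H -> vle Y (vup A) -> vle Y B].
Proof.
have [p ->] := coset_surj A; have [q ->] := coset_surj H; rewrite vupE.
move=> /vleE; case: p q => x f [y g] [/= c <-].
have [_ _ /(_ _ _ c) [w [d [dc dD dmax]]]] := hDelta.
exists (coset (Point (f * fhom iota d))); split.
- by apply/vleE; exists d.
- by apply/vleE/(@divides_cancel (Point f)).
- by apply/vleE/(@divides_cancel (Point f)).
move=> Y; have [[z h] ->] := coset_surj Y => /vleE [/= e <-].
move=> /vleE /(@divides_cancel (Point f)) ec.
move=> /vleE /(@divides_cancel (Point f)) eD.
by apply/vleE/(@divides_cancel (Point f)); exact: dmax.
Qed.

Lemma vle_anti (A B : vcoset) : vle A B -> vle B A -> A = B.
Proof.
have [p ->] := coset_surj A; have [q ->] := coset_surj B.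
by move=> /vleE pq /vleE qp; apply/cosetP.
Qed.

Lemma vle_up (A : vcoset) : vle A (vup A).
Proof.
have [p ->] := coset_surj A; rewrite vupE; apply/vleE.
by exists (Delta (base p)).
Qed.

Lemma vup_mono (A B : vcoset) : vle A B -> vle (vup A) (vup B).
Proof. by move=> AB; apply/vleE; exact: point_up_mono. Qed.

(** Writing the quotient of the two arrows as a fraction of [a] by [b] gives the common multiple. *)
Lemma vle_directed (A B : vcoset) : exists D, vle A D /\ vle B D.
Proof.
have [p ->] := coset_surj A; have [q ->] := coset_surj B.
have [f [pf fp]] := gcat_inv (arrow p).
have [z [a [b hab]]] := iota_fractional hOre hE (f * arrow q).
exists (coset (Point (arrow p * fhom iota a))).
split; apply/vleE; first by exists a.
by exists b; rewrite /= -hab -mcompA mcompA pf mcomp1m.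
Qed.

Definition coset_poset : garside_poset :=
  @GarsidePoset vcoset vle vup
  (fun A => divides_refl (repr A)) (fun A B D => @divides_trans _ _ _)
  vle_anti vle_up vup_mono vle_meet vle_ind vle_directed.

End CosetPoset.

(** * The action *)

Lemma finite_subsets (T : choiceType) (V : set T) :
  finite_set V -> finite_set [set s | s `<=` V].
Proof.
move=> fV; apply: (@sub_finite_set _ _
  ((fun A : {fset T} => [set` A]) @` [set` fpowerset (fset_set V)])).
  move=> s sV; have fs : finite_set s by exact: sub_finite_set fV.
  exists (fset_set s); last by rewrite fset_setK.
  rewrite /= fpowersetE; apply/fsubsetP => v.
  by rewrite !in_fset_set// => /set_mem /sV /mem_set.
by apply: finite_image; exact: finite_fset.
Qed.

Lemma simplex_bottom (P : garside_poset) (s : set P) : @simplex (gcomplex P) s ->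
  exists2 v, s v & forall w, s w -> gle v w.
Proof.
move=> ss; have [v0 sv0] := simplex_nonempty ss.
have fs := simplex_finite ss.
have bottom (l : seq P) : (forall w, w \in l -> s w) ->
    exists2 v, s v & gle v v0 /\ forall w, w \in l -> gle v w.
  elim: l => [_|w l IH ls]; first by exists v0 => //; split=> //; exact: gle_refl.
  have [|v sv [vv0 vl]] := IH.
    by move=> u ul; apply: ls; rewrite inE ul orbT.
  have sw : s w by apply: ls; rewrite inE eqxx.
  have [vw|wv] := gle_total ss sv sw.
    by exists v => //; split=> // u; rewrite inE => /orP[/eqP ->//|/vl].
  exists w => //; split; first exact: gle_trans wv vv0.
  move=> u; rewrite inE => /orP[/eqP ->|/vl vu]; first exact: gle_refl.
  exact: gle_trans wv vu.
have [|v sv [_ vs]] := bottom (fset_set s).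
  by move=> w; rewrite in_fset_set// => /set_mem.
by exists v => // w sw; apply: vs; rewrite in_fset_set// mem_set.
Qed.

Section Stabilizers.
Local Open Scope group_scope.
Variables (G : groupType) (X : simplicial_complex) (a : simplicial_action G X).

Lemma act_image1 (s : set X) : a 1 @` s = s.
Proof.
apply/seteqP; split=> [v [w sw <-]|v sv]; first by rewrite act1.
by exists v; rewrite ?act1.
Qed.

Lemma act_imageM g h (s : set X) : a (g * h) @` s = a g @` (a h @` s).
Proof.
apply/seteqP; split=> v.
  by move=> [w sw <-]; rewrite actM; exists (a h w) => //; exists w.
by move=> [_ [w sw <-] <-]; rewrite -actM; exists w.
Qed.

Lemma stabilizer_subgroup (s : set X) : subgroup (stabilizer a s).
Proof.
split=> [|g h gs hs|g gs]; rewrite /stabilizer /=.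
- exact: act_image1.
- by rewrite act_imageM hs gs.
- by rewrite -[in LHS]gs -act_imageM mulVg act_image1.
Qed.
End Stabilizers.

Section GarsideAction.
Local Open Scope cat_scope.
Variables (C : category) (hOre : right_ore C) (hfin : factor_finite C).
Variables (delta : C -> C) (Delta : forall x : C, mor x (delta x)).
Hypothesis hDelta : right_garside Delta.
Variables (E : groupoid) (iota : functor C E) (hE : enveloping_groupoid iota).
Variable pt : C.
Local Notation point := (point iota pt).
Local Notation Pos := (coset_poset hOre hDelta hE pt).
Local Notation X := (gcomplex Pos).
Local Notation G := (Loop (iota pt)).
Implicit Types (p q : point) (g h : G) (A B : vcoset iota pt).

Lemma interval_finite A B : vle A B ->
  finite_set [set D | vle A D /\ vle D B].
Proof.
have [p ->] := coset_surj A; have [q ->] := coset_surj B.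
move=> /vleE; case: p q => x f [y f'] [/= c <-].
have [n [r rP]] := hfin c.
(* A coset in the interval is given by a left-factor [d] of [c], viewed as a factor with trivial
   prefix. Its representative [r i] may have an invertible prefix, hence the product of prefix and
   middle term. *)
pose F (i : 'I_n) : vcoset iota pt :=
  coset (Point (f * fhom iota (fpre (r i) * fmor (r i)))).
apply: (@sub_finite_set _ _ (range F)); last exact/finite_image/finite_finset.
move=> D [/=]; have [[z k] ->] := coset_surj D => /vleE [/= d <-].
move=> /vleE /(divides_cancel hOre hE (p := Point f)) [e de].
have de1 : idm x * d * e = c by rewrite mcomp1m.
have [i [/= u [v [_ [v' [vv' v'v]] [/= ru rd _]]]]] := rP (Factor de1).
exists i => //; apply/cosetP; rewrite -ru mcomp1m.
split; apply/(divides_cancel hOre hE (p := Point f)).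
  by exists v; rewrite rd -!mcompA.
by exists v'; rewrite rd -!mcompA vv' mcompm1.
Qed.

Definition point_act g p : point := Point ((g : mor _ _) * arrow p).

Lemma divides_act g p q :
  divides (point_act g p) (point_act g q) <-> divides p q.
Proof.
split=> -[c pq]; exists c; last by rewrite /= -mcompA pq.
by move: pq => /=; rewrite -mcompA => /groupoid_mulIl.
Qed.

Definition vact g A : vcoset iota pt := coset (point_act g (repr A)).

Lemma vact_coset g p : vact g (coset p) = coset (point_act g p).
Proof.
by have [p1 p2] := repr_divides p; apply/cosetP; split; exact/divides_act.
Qed.

Lemma vle_act g A B : vle (vact g A) (vact g B) <-> vle A B.
Proof.
have [p ->] := coset_surj A; have [q ->] := coset_surj B.
by rewrite !vact_coset; split=> /vleE/divides_act/vleE.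
Qed.

Lemma vup_act g A : vup Delta (vact g A) = vact g (vup Delta A).
Proof.
have [p ->] := coset_surj A.
rewrite vact_coset !(vupE hDelta) vact_coset.
by rewrite /point_act /point_up /= mcompA.
Qed.

Lemma vact1 A : vact 1%g A = A.
Proof.
have [[x f] ->] := coset_surj A.
by rewrite vact_coset /point_act /= mcomp1m.
Qed.

Lemma vactM g h A : vact (g * h)%g A = vact g (vact h A).
Proof.
have [[x f] ->] := coset_surj A.
by rewrite !vact_coset /point_act /= mcompA.
Qed.

Lemma vact_simplex g (s : set X) : @simplex X s -> @simplex X (vact g @` s).
Proof.
move=> [fs [v sv] sadj]; split; first exact: finite_image.
  by exists (vact g v), v.
move=> _ _ [x sx <-] [y sy <-].
have [[xy yx]|[yx xy]] := sadj _ _ sx sy; [left|right]; split;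
  rewrite /= ?vup_act; exact/vle_act.
Qed.

Definition garside_action : simplicial_action G X :=
  @SimplicialAction G X vact vact1 vactM vact_simplex.

Lemma translateK g (s : set X) :
  garside_action g @` (garside_action g^-1%g @` s) = s.
Proof. by rewrite -act_imageM mulgV act_image1. Qed.

Lemma translates_cover (R : realType) x : exists K : set (set X),
  [/\ subcomplex K, compact (space_of R K) &
    forall (f : mor (iota pt) (iota x)) (s : set X), @simplex X s ->
      s (coset (Point f)) -> (forall v, s v -> vle (coset (Point f)) v) ->
      exists g, translate garside_action g K s].
Proof.
(* If no arrow of [E] joins [pt] to [x], the empty subcomplex serves. *)
have [[f0 _]|nof] := pselect (exists f : mor (iota pt) (iota x), True); last first.
  exists set0; split.
  - by split=> [s|s t] [].
  - by rewrite (_ : space_of R set0 = set0)//; exact: compact0.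
  - by move=> f; case: nof; exists f.
pose A0 := coset (Point f0).
pose V := [set D | vle A0 D /\ vle D (vup Delta A0)].
have fV : finite_set V by apply: interval_finite; exact: vle_up.
pose K := [set s : set X | simplex s /\ s `<=` V].
have sK : subcomplex K.
  split=> [s []//|s t [ss sV] ts t0]; split; first exact: simplex_face ss ts t0.
  exact: subset_trans sV.
exists K; split=> //.
  apply: compact_space_of => //; apply: sub_finite_set (finite_subsets fV).
  by move=> s [].
move=> f s ss sf sle; have [f0' [_ f0'f0]] := gcat_inv f0.
(* This [g] carries [f0] to [f], and so the interval above [f0] onto the one containing [s]. *)
pose g : G := f * f0'.
have gA0 : vact g A0 = coset (Point f).
  by rewrite vact_coset /point_act /= /g -mcompA f0'f0 mcompm1.
exists g, (garside_action g^-1%g @` s); last exact: translateK.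
split; first exact: act_simplex.
have gK v : vact g (vact g^-1%g v) = v by rewrite -vactM mulgV vact1.
move=> _ [v sv <-]; split; apply/(vle_act g); rewrite gK.
  by rewrite gA0; exact: sle.
by rewrite -vup_act gA0; exact: (gle_up_simplex ss sv sf).
Qed.

Lemma stabilizer_simplex (s : set X) : @simplex X s ->
  exists (x : C) (H : set (Loop (x : core C))),
    subgroup H /\ finite_index H /\
    isomorphic_subgroups (stabilizer garside_action s) H.
Proof.
move=> ss; have [v sv vs] := simplex_bottom ss.
have [[x f] vf] := coset_surj v.
have [f' [ff' f'f]] := gcat_inv f.
pose L := Loop (x : core C).
(* Conjugation by [f] identifies the invertible endomorphisms of [x] with the stabilizer of the
   vertex [v]. *)
pose c (u : L) : G := f * fhom iota (sval u) * f'.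
have cf (u : L) : (c u : mor _ _) * f = f * fhom iota (sval u).
  by rewrite /c -mcompA f'f mcompm1.
have cM (u w : L) : c (u * w)%g = (c u * c w)%g.
  apply: (groupoid_mulIr (h := f)); rewrite -[RHS]mcompA !cf mcompA cf -mcompA.
  by rewrite -fhomM.
have c_inj : injective c.
  move=> u w cuw; apply: iso_inj; apply: (iota_faithful hOre hE).
  by apply: (groupoid_mulIl (f := f)); rewrite -!cf cuw.
have c1 : c 1%g = 1%g.
  by apply: (mulgI (c 1%g)); rewrite -cM !mulg1.
have cV (u : L) : c u^-1%g = (c u)^-1%g.
  by apply: (mulgI (c u)); rewrite -cM !mulgV.
have c_fix (u : L) : vact (c u) v = v.
  rewrite vf vact_coset /point_act /= cf; have [w [uw wu]] := svalP u.
  apply/cosetP; split; first last.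
    by exists (sval u).
  by exists w; rewrite /= -mcompA -fhomM uw fhom1 mcompm1.
have c_surj g : vact g v = v -> exists u, c u = g.
  rewrite vf vact_coset /point_act /= => /cosetP[[/= a ga] [/= b fb]].
  have ab : a * b = idm x /\ b * a = idm x.
    split; apply: (iota_faithful hOre hE); rewrite fhomM fhom1.
      apply: (groupoid_mulIl (f := (g : mor _ _) * f)).
      by rewrite mcompA ga fb mcompm1.
    by apply: (groupoid_mulIl (f := f)); rewrite mcompA fb ga mcompm1.
  have ib : invertible b by exists a; case: ab.
  exists (exist _ b ib : L); apply: (groupoid_mulIr (h := f)).
  by rewrite cf.
(* An element stabilizing [s] preserves the order, so it fixes the least vertex. *)
have stab_fix g : stabilizer garside_action s g -> vact g v = v.
  move=> gs; have sgv : s (vact g v) by rewrite -gs; exists v.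
  have [w sw wv] : (garside_action g @` s) v by rewrite gs.
  apply: vle_anti; last exact: vs.
  by rewrite -[X in vle _ X]wv; apply/vle_act; exact: vs.
pose H : set L := [set u | stabilizer garside_action s (c u)].
have sH : subgroup H.
  have [h1 hM hV] := stabilizer_subgroup garside_action s.
  split=> [|u w|u]; rewrite /H /= ?c1 ?cM ?cV; first exact: h1.
    exact: hM.
  exact: hV.
exists x, H; split=> //; split.
  pose V := [set D : Pos | vle v D /\ vle D (vup Delta v)].
  have fV : finite_set V by apply: interval_finite; exact: vle_up.
  (* The coset of [u] consists of the elements moving [s] to the same simplex as [u]. All these
     translates lie in the finite interval from [v] to [up v]. *)
  pose cos (T : set X) : set L := [set u | garside_action (c u) @` s = T].
  apply: sub_finite_set (finite_image cos (finite_subsets fV)).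
  move=> _ [u _ <-]; exists (garside_action (c u) @` s).
    move=> _ [w sw <-]; split.
      by rewrite -(c_fix u); apply/vle_act; exact: vs.
    rewrite -(c_fix u) vup_act; apply/vle_act.
    exact: (gle_up_simplex ss sw sv).
  apply/seteqP; split=> w.
    move=> cw; exists (u^-1 * w)%g; last by rewrite mulVKg.
    suff : garside_action (c (u^-1 * w)%g) @` s = s by [].
    have {}cw : garside_action (c w) @` s = garside_action (c u) @` s by [].
    rewrite cM act_imageM cw -act_imageM cV.
    by rewrite mulVg act_image1.
  move=> [h Hh <-]; suff : garside_action (c (u * h)%g) @` s =
    garside_action (c u) @` s by [].
  by rewrite cM act_imageM Hh.
(* The inverse of [c] on its image, with default value 1 elsewhere. *)
pose phi g : L := xget 1%g [set u | c u = g].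
have phic u : phi (c u) = u.
  by rewrite /phi; case: xgetP => [w _ /c_inj|/(_ u) []].
have cphi g : stabilizer garside_action s g -> c (phi g) = g.
  by move=> /stab_fix /c_surj[u <-]; rewrite phic.
exists phi; split; first split.
- by move=> g gs; rewrite /H /= cphi.
- by move=> g h /set_mem gs /set_mem hs gh; rewrite -(cphi g)// gh cphi.
- by move=> u Hu; exists (c u).
- move=> g h gs hs; apply: c_inj; rewrite cM !cphi//.
  by have [_ hM _] := stabilizer_subgroup garside_action s; exact: hM.
Qed.

End GarsideAction.

Theorem theorem1 (R : realType) (C : category)
    (hOre : right_ore C) (hfin : factor_finite C)
    (delta : C -> C) (Delta : forall x : C, mor x (delta x))
    (hDelta : right_garside Delta)
    (pt : C)
    (E : groupoid) (iota : functor C E) (hE : enveloping_groupoid iota) :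
  exists (X : simplicial_complex) (a : simplicial_action (Loop (iota pt)) X),
    contractible R (realization R X) /\
    (exists K : C -> set (set X),
       (forall x : C, subcomplex (K x) /\ compact (space_of R (K x))) /\
       \bigcup_x \bigcup_g space_of R (translate a g (K x))
         = [set: realization R X]) /\
    (forall s : set X, simplex s ->
       exists (x : C) (H : set (Loop (x : core C))),
         subgroup H /\ finite_index H /\
         isomorphic_subgroups (stabilizer a s) H).
Proof.
exists (gcomplex (coset_poset hOre hDelta hE pt)).
exists (garside_action hOre hDelta hE pt).
split; [|split]; last by move=> s; exact: stabilizer_simplex.
  exact: (@gcomplex_contractible R (coset_poset hOre hDelta hE pt)
    (coset (Point (idm (iota pt))))).
have /choice[K hK] := fun x => translates_cover hOre hfin hDelta hE pt R x.
exists K; split; first by move=> x; have [? ? _] := hK x.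
apply/seteqP; split=> // t _; have ts := coord_carrier t.
(* The least vertex of the carrier of [t] selects the object [x] whose compact piece has a translate
   containing [t]. *)
have [v tv vt] := simplex_bottom ts; have [[x f] vf] := coset_surj v.
have [_ _ /(_ f _ ts)] := hK x; rewrite -vf => /(_ tv vt)[g gt].
by exists x => //; exists g.
Qed.
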